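(* Let $N\ge 2$, let $A\in\mathbb{R}^{n\times n}$ and $B\in\mathbb{R}^{n\times p}$ be such that $(A,B)$ is controllable, and let $Q\in\mathbb{R}^{Nn\times Nn}$ and $R\in\mathbb{R}^{Np\times Np}$ satisfy $Q>0$, $R>0$. Let $P_{\mathscr{A}}\in\mathbb{R}^{Nn\times Nn}$ be the orthogonal projection onto the asynchronous subspace $\mathscr{A}=\mathscr{S}^{\perp}$, where $\mathscr{S}=\operatorname{Im}(\mathbf{1}_N\otimes I_n)$. Then the solution to the optimal synchronization problem $$\underset{u(\cdot)}{\text{minimize}}\ \int_0^\infty \left(x^\top P_{\mathscr{A}}^\top Q P_{\mathscr{A}}x+u^\top R u\right)dt\quad\text{subject to}\quad \dot{x}=(I_N\otimes A)x+(I_N\otimes B)u$$ is given by $u=Kx$, where $K\in\mathbb{R}^{Np\times Nn}$ is diffusive, i.e. $K(\mathbf{1}_N\otimes I_n)=0$.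
   Context: $N$ homogeneous linear systems $\dot{x}_i=Ax_i+Bu_i$, $i=1,\dots,N$, are stacked as $x=(x_1,\dots,x_N)\in\mathbb{R}^{Nn}$, $u=(u_1,\dots,u_N)\in\mathbb{R}^{Np}$. $\mathbf{1}_N\in\mathbb{R}^N$ is the all-ones vector, $I_k$ is the $k\times k$ identity matrix, $\otimes$ is the Kronecker product. $M>0$ means $M$ is symmetric positive definite. The synchronization subspace is $\mathscr{S}=\operatorname{Im}(\mathbf{1}_N\otimes I_n)\subset\mathbb{R}^{Nn}$ and the asynchronous subspace $\mathscr{A}$ is its orthogonal complement. A matrix $K\in\mathbb{R}^{Np\times Nn}$ is called diffusive if $K(\mathbf{1}_N\otimes I_n)=0$. Convention for the optimal control problem: the initial state $x(0)$ is an arbitrary given vector; the minimization is over all input functions $u:[0,\infty)\to\mathbb{R}^{Np}$ (say, locally square integrable, so that the state trajectory is well defined), with no requirement that the resulting state trajectory converge to the origin. ''The solution is given by $u=Kx$'' means that there is one constant matrix $K$, not depending on $x(0)$, such that for every initial state the input generated by the feedback $u(t)=Kx(t)$ attains the minimum of the cost. *)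

(* Defs.v *)
From HB Require Import structures.
From mathcomp Require Import all_boot all_order all_algebra.
From mathcomp Require Export mxtens.
From mathcomp Require Import all_classical all_reals all_analysis.

Set Implicit Arguments.
Unset Strict Implicit.
Unset Printing Implicit Defensive.

Import Order.TTheory GRing.Theory Num.Theory.
Import numFieldNormedType.Exports.

Local Open Scope classical_set_scope.
Local Open Scope ring_scope.

Definition qform (R : realType) (m : nat) (M : 'M[R]_m) (x : 'cV[R]_m) : R :=
  (x^T *m M *m x) 0 0.

Definition posdefmx (R : realType) (m : nat) (M : 'M[R]_m) : Prop :=
  M^T = M /\ forall x : 'cV[R]_m, x != 0 -> 0 < qform M x.

(* The Kronecker product [A *t B] places entry (i, k) of a stacked vector at
   position i * n + k, so ['cV_(N * n)] is (x_1, ..., x_N) with blocks of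
   size n. *)
Definition ones_kron (R : realType) (N n : nat) : 'M[R]_(N * n, 1 * n) :=
  (const_mx 1 : 'cV[R]_N) *t (1%:M : 'M[R]_n).

Definition sync_subspace (R : realType) (N n : nat) : set 'cV[R]_(N * n) :=
  range (fun w : 'cV[R]_(1 * n) => ones_kron R N n *m w).

Definition orth_compl (R : realType) (m : nat) (V : set 'cV[R]_m) :
    set 'cV[R]_m :=
  [set x | forall v, V v -> v^T *m x = 0].

Definition async_subspace (R : realType) (N n : nat) : set 'cV[R]_(N * n) :=
  orth_compl (@sync_subspace R N n).

Definition is_orth_proj (R : realType) (m : nat) (V : set 'cV[R]_m)
    (P : 'M[R]_m) : Prop :=
  forall x : 'cV[R]_m, V (P *m x) /\ orth_compl V (x - P *m x).

Definition diffusive (R : realType) (N n p : nat)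
    (K : 'M[R]_(N * p, N * n)) : Prop :=
  K *m ones_kron R N n = 0.

(* Inputs and trajectories are total functions on R; only their values on
   [0, +oo[ are ever used. *)
Definition loc_square_integrable (R : realType) (q : nat)
    (u : R -> 'cV[R]_q) : Prop :=
  forall i : 'I_q,
    measurable_fun (`[0, +oo[ : set R) (fun t => u t i 0) /\
    forall T : R, 0 <= T ->
      (@lebesgue_measure R).-integrable `[0, T]
        (fun t => ((u t i 0) ^+ 2)%:E).

(* Caratheodory solution of x' = A x + B u with x(0) = x0, in integrated
   form. *)
Definition trajectory (R : realType) (m q : nat) (A : 'M[R]_m)
    (B : 'M[R]_(m, q)) (x0 : 'cV[R]_m) (u : R -> 'cV[R]_q)
    (x : R -> 'cV[R]_m) : Prop :=
  forall (t : R) (i : 'I_m), 0 <= t ->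
    (@lebesgue_measure R).-integrable `[0, t]
      (fun s => ((A *m x s + B *m u s) i 0)%:E) /\
    x t i 0 = x0 i 0 +
      \int[@lebesgue_measure R]_(s in `[0, t]) ((A *m x s + B *m u s) i 0).

Definition controllable (R : realType) (m q : nat) (A : 'M[R]_m)
    (B : 'M[R]_(m, q)) : Prop :=
  forall x0 x1 : 'cV[R]_m,
    exists (T : R) (u : R -> 'cV[R]_q) (x : R -> 'cV[R]_m),
      [/\ 0 < T, loc_square_integrable u, trajectory A B x0 u x & x T = x1].

Definition cost (R : realType) (m q : nat) (W : 'M[R]_m) (S : 'M[R]_q)
    (x : R -> 'cV[R]_m) (u : R -> 'cV[R]_q) : \bar R :=
  (\int[@lebesgue_measure R]_(t in `[0%R, +oo[)
     (qform W (x t) + qform S (u t))%:E)%E.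

(* The pair (x, u) attains the minimum, as a real number, of the cost over
   all admissible inputs from x0; no condition at infinity is imposed. *)
Definition optimal_from (R : realType) (m q : nat) (A : 'M[R]_m)
    (B : 'M[R]_(m, q)) (W : 'M[R]_m) (S : 'M[R]_q) (x0 : 'cV[R]_m)
    (x : R -> 'cV[R]_m) (u : R -> 'cV[R]_q) : Prop :=
  [/\ loc_square_integrable u,
      trajectory A B x0 u x,
      (cost W S x u < +oo)%E &
      forall (v : R -> 'cV[R]_q) (y : R -> 'cV[R]_m),
        loc_square_integrable v -> trajectory A B x0 v y ->
        (cost W S x u <= cost W S y v)%E].

Definition optimal_feedback (R : realType) (m q : nat) (A : 'M[R]_m)
    (B : 'M[R]_(m, q)) (W : 'M[R]_m) (S : 'M[R]_q) (K : 'M[R]_(q, m)) : Prop :=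
  forall x0 : 'cV[R]_m, exists x : R -> 'cV[R]_m,
    optimal_from A B W S x0 x (fun t => K *m x t).

(* Main.v *)
Require Import Defs.
From HB Require Import structures.
From mathcomp Require Import all_boot all_order all_algebra.
From mathcomp Require Import all_classical all_reals all_analysis measurable_realfun.
From mathcomp Require Import ring lra.

(** Let V x0 be the infimum of the cost over all inputs, starting from x0.  It
    is finite: controllability steers each agent to the origin in finite time,
    and the zero input costs nothing from there on.  The cost is quadratic and
    the dynamics is linear, so V is homogeneous of degree two and satisfies the
    parallelogram law; hence V x = x^T P x for a positive semidefinite P
    ([jordan_von_neumann], [value_qform]).  Since the state is not required to
    converge, P has to be the smallest solution of the Riccati equation and not
    the stabilising one; defining it by the infimum selects it at once and
    avoids Riccati differential equations.

    The optimal gain is K = - S^-1 B^T P.  Put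
      D = A^T P + P A + W - P B S^-1 B^T P.
    Along the closed loop z' = (A + B K) z the derivative of z^T P z is z^T D z
    minus the running cost.  So as soon as D <= 0, the cost on [0, T] is at most
    V x0 - V (z T) <= V x0 for every T, and the feedback attains the infimum
    ([closed_loop_cost]).

    That D <= 0 ([riccati_residual_le0]) is dynamic programming over a short
    time t.  The tail of a nearly optimal trajectory costs at least V (x t), so
    the cost on [0, t] plus V (x t) exceeds V x0 by an arbitrarily small amount.
    V is convex, hence above its linearisation at x0; by completing the square
    in u, the resulting integrand is at least x0^T D x0 up to a multiple of the
    distance from x to x0 ([linearised_cost_ge]).  This distance is o(t) in
    mean, because the control energy is bounded a priori by V x0 + 1
    ([deviation_l1_le]), and dividing by t gives x0^T D x0 <= 0.

    Finally, from a synchronised state the zero input keeps all agents equal, so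
    the projection on the asynchronous subspace vanishes and the cost is zero.
    There V x0 = 0, hence P x0 = 0 because P is positive semidefinite, and
    K x0 = 0: the gain is diffusive. *)

Set Implicit Arguments.
Unset Strict Implicit.
Unset Printing Implicit Defensive.

Import Order.TTheory GRing.Theory Num.Theory.
Import numFieldNormedType.Exports.

Local Open Scope classical_set_scope.
Local Open Scope ring_scope.

(** * Quadratic forms *)

Section BilinearForms.
Context {R : realType}.

Definition bform (m q : nat) (M : 'M[R]_(m, q)) (x : 'cV[R]_m) (y : 'cV[R]_q) : R :=
  (x^T *m M *m y) 0 0.

Section Bilinear.
Variables m q : nat.
Implicit Types (M : 'M[R]_(m, q)) (x : 'cV[R]_m) (y : 'cV[R]_q).

Lemma bformDl M x x' y : bform M (x + x') y = bform M x y + bform M x' y.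
Proof. by rewrite /bform raddfD /= !mulmxDl mxE. Qed.

Lemma bformDr M x y y' : bform M x (y + y') = bform M x y + bform M x y'.
Proof. by rewrite /bform mulmxDr mxE. Qed.

Lemma bformZl M a x y : bform M (a *: x) y = a * bform M x y.
Proof. by rewrite /bform linearZ /= -!scalemxAl mxE. Qed.

Lemma bformZr M a x y : bform M x (a *: y) = a * bform M x y.
Proof. by rewrite /bform -scalemxAr mxE. Qed.

Lemma bformDm M M' x y : bform (M + M') x y = bform M x y + bform M' x y.
Proof. by rewrite /bform mulmxDr mulmxDl mxE. Qed.

Lemma bformNm M x y : bform (- M) x y = - bform M x y.
Proof. by rewrite /bform mulmxN mulNmx mxE. Qed.

Lemma bform_trmx M x y : bform M^T y x = bform M x y.
Proof.
rewrite /bform -[in RHS](trmxK (x^T *m M *m y)) [in RHS]mxE.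
by rewrite [in RHS]trmx_mul [in RHS]trmx_mul trmxK mulmxA.
Qed.

Lemma bformE M x y : bform M x y = \sum_i \sum_j M i j * (x i 0 * y j 0).
Proof.
rewrite /bform -mulmxA mxE; apply: eq_bigr => i _.
rewrite !mxE mulr_sumr; apply: eq_bigr => j _; rewrite mulrCA mulrA; ring.
Qed.

Lemma bform_mulr p M (L : 'M[R]_(q, p)) x (z : 'cV_p) :
  bform M x (L *m z) = bform (M *m L) x z.
Proof. by rewrite /bform !mulmxA. Qed.

Lemma bform_mull p (L : 'M[R]_(m, p)) M (z : 'cV_p) y :
  bform M (L *m z) y = bform (L^T *m M) z y.
Proof. by rewrite /bform trmx_mul !mulmxA. Qed.

End Bilinear.

Variable m : nat.
Implicit Types (M : 'M[R]_m) (x y : 'cV[R]_m).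

Lemma bform_qform M x : bform M x x = qform M x. Proof. by []. Qed.

Lemma bformC M x y : M^T = M -> bform M x y = bform M y x.
Proof. by move=> sM; rewrite -bform_trmx sM. Qed.

Lemma qformDm M M' x : qform (M + M') x = qform M x + qform M' x.
Proof. exact: bformDm. Qed.

Lemma qformNm M x : qform (- M) x = - qform M x.
Proof. exact: bformNm. Qed.

Lemma qformZ M a x : qform M (a *: x) = a ^+ 2 * qform M x.
Proof. by rewrite -!bform_qform bformZl bformZr mulrA expr2. Qed.

Lemma qformD M x y : M^T = M ->
  qform M (x + y) = qform M x + 2 * bform M x y + qform M y.
Proof.
move=> sM; rewrite -!bform_qform !(bformDl, bformDr) (bformC y x sM); ring.
Qed.

Lemma qform_mul q (L : 'M[R]_(m, q)) M (z : 'cV_q) :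
  qform M (L *m z) = qform (L^T *m M *m L) z.
Proof. by rewrite -!bform_qform bform_mulr bform_mull mulmxA. Qed.

Lemma qform_parallelogram M x y :
  qform M (x + y) + qform M (x - y) = 2 * qform M x + 2 * qform M y.
Proof.
rewrite -!bform_qform -scaleN1r !(bformDl, bformDr, bformZl, bformZr); ring.
Qed.

Definition possemidefmx M := M^T = M /\ forall x, 0 <= qform M x.

Lemma posdefmx_possemidef M : posdefmx M -> possemidefmx M.
Proof.
move=> [sM pM]; split=> // x; have [->|/pM/ltW//] := eqVneq x 0.
by rewrite -(scale0r (0 : 'cV[R]_m)) qformZ expr0n mul0r.
Qed.

Lemma posdefmx_unit M : posdefmx M -> M \in unitmx.
Proof.
move=> [sM pM]; rewrite -row_free_unit -kermx_eq0; apply: contraT => /rowV0Pn[v].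
move=> /sub_kermxP vM v0.
have := pM v^T; rewrite -(inj_eq (can_inj (@trmxK _ _ _))) trmxK trmx0.
by move=> /(_ v0); rewrite /qform trmxK vM mul0mx mxE ltxx.
Qed.

(** A minimum of the form is a critical point: perturbing x by a small multiple
    of M x would make the form negative unless M x = 0. *)
Lemma possemidef_qform0 M x : possemidefmx M -> qform M x = 0 -> M *m x = 0.
Proof.
move=> [sM pM] x0; set y := M *m x.
have yy : bform M x y = \sum_i y i 0 ^+ 2.
  rewrite (bformC _ _ sM) /bform -mulmxA mxE.
  by apply: eq_bigr => i _; rewrite mxE.
have ge (s : R) : 0 <= 2 * s * bform M x y + s ^+ 2 * qform M y.
  by have := pM (x + s *: y); rewrite qformD// x0 qformZ bformZr; lra.
have yy0 : bform M x y = 0.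
  apply/eqP; rewrite eq_le yy sumr_ge0 ?andbT; last by move=> i _; exact: sqr_ge0.
  rewrite -yy; have q0 := pM y; set b := bform _ _ _ in ge *; set c := qform M y in ge q0.
  rewrite leNgt; apply/negP => b0; have c1 : 0 < c + 1 by lra.
  (* c + 1 rather than c, which may vanish. *)
  have := ge (- (b / (c + 1))).
  have -> : 2 * - (b / (c + 1)) * b + (- (b / (c + 1))) ^+ 2 * c =
     - (b / (c + 1)) ^+ 2 * (c + 2) by field; rewrite gt_eqF.
  have c2 : 0 < c + 2 by lra.
  have := mulr_gt0 (exprn_gt0 2 (divr_gt0 b0 c1)) c2.
  by rewrite mulNr oppr_ge0 => /lt_geF ->.
move: yy0; rewrite yy => /psumr_eq0P y0.
apply/colP => i; rewrite [RHS]mxE; apply/eqP; rewrite -sqrf_eq0; apply/eqP.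
by apply: y0 => // j _; exact: sqr_ge0.
Qed.

End BilinearForms.

(** * Quadratic functions are quadratic forms *)

Section JordanVonNeumann.
Context {R : realType}.

(** The defect b |-> f b - b * f 1 is additive and vanishes on integers, so it
    is bounded on the whole line by its bound on the unit interval; a bounded
    additive function is zero. *)
Lemma additive_bounded_linear (f : R -> R) (C : R) :
  (forall a b, f (a + b) = f a + f b) ->
  (forall a, `|a| <= 1 -> `|f a| <= C) ->
  forall a, f a = a * f 1.
Proof.
move=> fD fC a; pose g b := f b - b * f 1.
have gD b c : g (b + c) = g b + g c by rewrite /g fD; ring.
have f0 : f 0 = 0 by have := fD 0 0; rewrite addr0; lra.
have gn b n : g (b * n%:R) = g b * n%:R.
  elim: n => [|n IH]; first by rewrite /g !mulr0 f0 mul0r subrr.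
  by rewrite -natr1 !mulrDr !mulr1 gD IH.
have g1 : g 1 = 0 by rewrite /g mul1r subrr.
have gi (k : int) : g k%:~R = 0.
  case: k => n; first by rewrite -pmulrn -(mul1r n%:R) gn g1 mul0r.
  have := gD (Negz n)%:~R n.+1%:R.
  rewrite NegzE mulrNz -pmulrn addNr -[in g n.+1%:R](mul1r n.+1%:R) gn g1 mul0r addr0.
  by rewrite {1}/g f0 mul0r subr0 => <-.
have gC b : `|b| <= 1 -> `|g b| <= C + `|f 1|.
  move=> b1; rewrite /g (le_trans (ler_normB _ _))// lerD ?fC//.
  by rewrite normrM ler_piMl.
have gB b : `|g b| <= C + `|f 1|.
  have -> : g b = g (b - (Num.floor b)%:~R).
    by have := gD (b - (Num.floor b)%:~R) (Num.floor b)%:~R; rewrite subrK gi addr0.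
  apply: gC; have /andP[h1 h2] := floor_itv b.
  by rewrite ger0_norm ?subr_ge0// lerBlDl (le_trans (ltW h2))// intrD addrC.
suff : g a = 0 by rewrite /g; lra.
apply/eqP; rewrite -normr_le0 leNgt; apply/negP => ga.
set D := C + _ in gB.
have := gB (a * (Num.truncn (D / `|g a|)).+1%:R); rewrite gn normrM normr_nat leNgt.
by rewrite mulrC -ltr_pdivrMr// truncnS_gt.
Qed.

(** Polarisation gives an additive form; nonnegativity of V bounds it on bounded
    scalars, which is the regularity needed to get homogeneity over the
    reals. *)
Lemma jordan_von_neumann (m : nat) (V : 'cV[R]_m -> R) :
  (forall x, 0 <= V x) ->
  (forall a x, V (a *: x) = a ^+ 2 * V x) ->
  (forall x y, V (x + y) + V (x - y) = 2 * V x + 2 * V y) ->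
  exists P : 'M[R]_m, possemidefmx P /\ V = qform P.
Proof.
move=> V0 VZ VP.
pose b x y := (V (x + y) - V (x - y)) / 4.
have VN x : V (- x) = V x by rewrite -scaleN1r VZ; ring.
have bC x y : b x y = b y x by rewrite /b (addrC x) -(VN (x - y)) opprB.
have b0 y : b 0 y = 0 by rewrite /b add0r sub0r VN; lra.
have b2 x z y : b (x + z) y + b (x - z) y = 2 * b x y.
  have := VP (x + y) z; have := VP (x - y) z; rewrite /b.
  rewrite (addrAC x y z) (addrAC x y (- z)) (addrAC x (- y) z) (addrAC x (- y) (- z)).
  lra.
have bD x z y : b (x + z) y = b x y + b z y.
  have h x' : b (2 *: x') y = 2 * b x' y.
    by have := b2 x' x' y; rewrite subrr b0 addr0 -mulr2n -scaler_nat.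
  have half (v : 'cV[R]_m) : 2^-1 *: (v + v) = v.
    by rewrite -mulr2n -(scaler_nat 2 v) scalerA mulVf// scale1r.
  have := b2 (2^-1 *: (x + z)) (2^-1 *: (x - z)) y.
  rewrite -h scalerA mulfV ?scale1r// -scalerDr -scalerBr.
  rewrite addrACA subrr addr0 opprB (addrC (x + z)) addrA subrK !half.
  by move=> ->.
have bZ a x y : b (a *: x) y = a * b x y.
  pose f c := b (c *: x) y.
  rewrite -[b x y]/(b x y) -{2}[x]scale1r.
  apply: (@additive_bounded_linear f (V x + V y)) => [c d|c c1].
    by rewrite /f scalerDl bD.
  have := VP (c *: x) y; have := V0 (c *: x + y); have := V0 (c *: x - y).
  rewrite VZ /f /b => h1 h2 h3.
  have : c ^+ 2 * V x <= V x.
    by rewrite ler_piMl// -(real_normK (num_real c)) exprn_ile1.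
  have := V0 x; have := V0 y.
  by rewrite ler_norml; move=> *; apply/andP; split; lra.
have bDr x y z : b x (y + z) = b x y + b x z by rewrite bC bD !(bC x).
have bZr a x y : b x (a *: y) = a * b x y by rewrite bC bZ (bC x).
have bsuml (I : finType) (F : I -> 'cV[R]_m) y : b (\sum_i F i) y = \sum_i b (F i) y.
  by apply: (big_morph (b^~ y)) => // x z; rewrite bD.
have bsumr (I : finType) (F : I -> 'cV[R]_m) y : b y (\sum_i F i) = \sum_i b y (F i).
  by rewrite bC bsuml; apply: eq_bigr => i _; rewrite bC.
have Vb x : V x = b x x.
  by rewrite /b subrr -(scale0r (0 : 'cV[R]_m)) !VZ -mulr2n -scaler_nat VZ; field.
pose e (i : 'I_m) : 'cV[R]_m := delta_mx i 0.
have xe (x : 'cV[R]_m) : x = \sum_i x i 0 *: e i.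
  rewrite [LHS]matrix_sum_delta; apply: eq_bigr => i _.
  by rewrite big_ord_recl big_ord0 addr0.
pose P := \matrix_(i, j) b (e i) (e j) : 'M[R]_m.
have VPq : V = qform P.
  have bl x y : b x y = \sum_i x i 0 * b (e i) y.
    by rewrite {1}(xe x) bsuml; apply: eq_bigr => i _; rewrite bZ.
  apply/funext => x; rewrite -bform_qform bformE Vb bl.
  apply: eq_bigr => i _; rewrite bC bl mulr_sumr.
  by apply: eq_bigr => j _; rewrite mxE mulrA (bC (e i)) [RHS]mulrC.
exists P; split=> //; split; last by move=> x; rewrite -VPq.
by apply/matrixP => i j; rewrite !mxE bC.
Qed.

End JordanVonNeumann.

(** * Translation invariance of the Lebesgue measure *)

Section Translation.
Context {R : realType}.
Local Notation mu := (@lebesgue_measure R).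
Implicit Type a : R.

Lemma preimage_addr_itv a (b0 b1 : bool) (b c : R) :
  (fun r => r + a) @^-1` [set` Interval (BSide b0 b) (BSide b1 c)] =
  [set` Interval (BSide b0 (b - a)) (BSide b1 (c - a))].
Proof.
apply/seteqP; split=> r /=; rewrite !in_itv/=;
  by case: b0; case: b1; rewrite /= ?lerBlDr ?ltrBlDr ?lerBrDr ?ltrBrDr.
Qed.

Lemma preimage_addr_itvy a (b0 : bool) (b : R) :
  (fun r => r + a) @^-1` [set` Interval (BSide b0 b) +oo%O] =
  [set` Interval (BSide b0 (b - a)) +oo%O].
Proof.
apply/seteqP; split=> r /=; rewrite !in_itv/= !andbT;
  by case: b0; rewrite /= ?lerBlDr ?ltrBlDr.
Qed.

Lemma measurable_addr a :
  measurable_fun setT ((fun r => r + a) : measurableTypeR R -> measurableTypeR R).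
Proof. exact: measurable_funD. Qed.

(** Both measures agree on half-open intervals, which determine the Lebesgue
    measure. *)
Lemma lebesgue_measure_translation a (A : set R) : measurable A ->
  pushforward mu ((fun r => r + a) : _ -> measurableTypeR R) A = mu A.
Proof.
move=> mA; apply/esym/lebesgue_measure_unique => //=; first exact: measurable_addr.
move=> _ _ [[b c]] _ <-.
rewrite /pushforward preimage_addr_itv/= !lebesgue_measure_itv/=.
rewrite !lte_fin ltrD2r; case: ifPn => // _.
by rewrite -!EFinB; congr EFin; ring.
Qed.

Lemma ge0_integral_translation a (D : set R) (f : R -> \bar R) : measurable D ->
    measurable_fun D f -> (forall y, D y -> 0 <= f y)%E ->
  (\int[mu]_(y in D) f y = \int[mu]_(x in (fun r => r + a)%R @^-1` D) f (x + a)%R)%E.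
Proof.
move=> mD mf f0; rewrite -[RHS](ge0_integral_pushforward (measurable_addr a))//.
- apply: eq_measure_integral => [|? A mA _]; first exact: measurable_addr.
  by apply/esym; exact: lebesgue_measure_translation.
- by move=> y /set_mem; exact: f0.
Qed.

Lemma integral_translation a (D : set R) (f : R -> \bar R) : measurable D ->
    measurable_fun D f ->
  (\int[mu]_(y in D) f y = \int[mu]_(x in (fun r => r + a)%R @^-1` D) f (x + a)%R)%E.
Proof.
move=> mD mf; rewrite integralE [RHS]integralE.
rewrite (ge0_integral_translation a mD)//; last exact: measurable_funepos.
rewrite (ge0_integral_translation a mD)//; last exact: measurable_funeneg.
by congr (_ - _)%E; apply: eq_integral => x _; rewrite ?funeposE ?funenegE.
Qed.

Lemma measurable_fun_translation a (D : set R) d (T : measurableType d) (f : R -> T) :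
    measurable D -> measurable_fun D f ->
  measurable_fun ((fun r => r + a) @^-1` D) (fun x => f (x + a)).
Proof.
move=> mD mf; apply: (measurable_comp mD _ mf); first by move=> _ [x Dx <-].
exact: (measurable_funTS (measurable_addr a)).
Qed.

Lemma integrable_translation a (D : set R) (f : R -> \bar R) : measurable D ->
  mu.-integrable D f -> mu.-integrable ((fun r => r + a) @^-1` D) (fun x => f (x + a)).
Proof.
move=> mD /integrableP[mf foo]; apply/integrableP; split.
  exact: measurable_fun_translation.
rewrite -(ge0_integral_translation a (f := fun x => `|f x|%E) mD)//.
exact: measurableT_comp.
Qed.

Lemma Rintegral_translation a (D : set R) (f : R -> R) : measurable D ->
    measurable_fun D f ->
  \int[mu]_(y in D) f y = \int[mu]_(x in (fun r => r + a) @^-1` D) f (x + a).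
Proof.
move=> mD mf; rewrite /Rintegral (integral_translation a mD)//.
exact/measurable_EFinP.
Qed.

End Translation.

(** * Locally square integrable signals *)

Section SquareIntegrable.
Context {R : realType}.
Local Notation mu := (@lebesgue_measure R).

(** The integrability predicate takes extended-real functions; these variants keep
    whole real expressions under the embedding, as the trajectory and cost
    integrands do. *)
Lemma integrable_addr (D : set (measurableTypeR R)) (f g : R -> R) : measurable D ->
    mu.-integrable D (fun t => (f t)%:E) -> mu.-integrable D (fun t => (g t)%:E) ->
  mu.-integrable D (fun t => (f t + g t)%:E).
Proof. by move=> mD fi gi; exact: (integrableD mD fi gi). Qed.

Lemma integrable_mulr (D : set (measurableTypeR R)) (a : R) (f : R -> R) : measurable D ->
    mu.-integrable D (fun t => (f t)%:E) -> mu.-integrable D (fun t => (a * f t)%:E).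
Proof. by move=> mD fi; exact: (integrableZl mD a fi). Qed.

Lemma eq_integrabler (D : set (measurableTypeR R)) (f g : R -> R) : f =1 g ->
  mu.-integrable D (fun t => (f t)%:E) -> mu.-integrable D (fun t => (g t)%:E).
Proof. by move=> /funext ->. Qed.

Lemma integrable_sumr (I : finType) (D : set (measurableTypeR R)) (f : I -> R -> R) :
    measurable D -> (forall i, mu.-integrable D (fun t => (f i t)%:E)) ->
  mu.-integrable D (fun t => (\sum_i f i t)%:E).
Proof.
move=> mD fi; rewrite (_ : (fun t => _) = fun t => (\sum_i (f i t)%:E)%E).
  by apply: integrable_sum => // i _; exact: fi.
by apply/funext => t; rewrite sumEFin.
Qed.

Lemma Rintegral_sumr (I : finType) (D : set (measurableTypeR R)) (f : I -> R -> R) :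
    measurable D -> (forall i, mu.-integrable D (fun t => (f i t)%:E)) ->
  \int[mu]_(t in D) (\sum_i f i t) = \sum_i \int[mu]_(t in D) f i t.
Proof.
move=> mD fi; rewrite /Rintegral; under eq_integral do rewrite -sumEFin.
rewrite integral_sum//; rewrite -sum_fine// => i _.
exact: integrable_fin_num (fi i).
Qed.

(** Scalar counterpart of [loc_square_integrable]: the components of an admissible
    input, of a trajectory and of a velocity all belong to this class, which is
    stable under linear combinations. *)
Definition sqint (f : R -> R) : Prop :=
  measurable_fun (`[0, +oo[ : set R) f /\
  forall T : R, 0 <= T -> mu.-integrable `[0, T] (fun t => ((f t) ^+ 2)%:E).

Lemma subset_itv0y (T : R) : `[0, T] `<=` (`[0, +oo[ : set R).
Proof. by move=> t /=; rewrite !in_itv/= andbT => /andP[]. Qed.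

Lemma sqint_measurable f (T : R) : sqint f -> measurable_fun `[0, T] f.
Proof. by move=> [mf _]; apply: measurable_funS mf => //; exact: subset_itv0y. Qed.

(** From |f g| <= f^2 + g^2. *)
Lemma sqintM_integrable f g (T : R) : sqint f -> sqint g -> 0 <= T ->
  mu.-integrable `[0, T] (fun t => (f t * g t)%:E).
Proof.
move=> hf hg T0.
apply: (@le_integrable _ _ _ mu _ _ _ (fun t => ((f t) ^+ 2 + (g t) ^+ 2)%:E)) => //.
- by apply/measurable_EFinP/measurable_funM; exact: sqint_measurable.
- move=> t _; rewrite /= lee_fin [leRHS]ger0_norm ?addr_ge0 ?sqr_ge0//.
  have := sqr_ge0 (f t + g t); have := sqr_ge0 (f t - g t).
  have := sqr_ge0 (f t); have := sqr_ge0 (g t).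
  by rewrite ler_norml !expr2 => *; apply/andP; split; lra.
- by apply: integrable_addr => //; [exact: hf.2|exact: hg.2].
Qed.

Lemma continuous_sqint f :
  (forall T : R, 0 <= T -> {within `[0, T], continuous f}) -> sqint f.
Proof.
move=> cf; split=> [|T T0].
  have -> : `[0, +oo[%classic = \bigcup_(n : nat) `[0, n%:R : R]%classic.
    apply/seteqP; split=> [t /=|t [n _ /=]]; rewrite !in_itv/= ?andbT; last by case/andP.
    move=> t0; exists (Num.truncn t).+1 => //=; rewrite in_itv/= t0/=.
    exact/ltW/truncnS_gt.
  apply/measurable_fun_bigcup => // n.
  by apply: subspace_continuous_measurable_fun => //; exact: cf.
apply: continuous_compact_integrable; first exact: segment_compact.
move=> t; apply: (@continuousM _ (subspace `[0, T])); exact: cf.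
Qed.

Lemma sqint_cst c : sqint (cst c).
Proof. by apply: continuous_sqint => T _; apply: continuous_subspaceT => t; exact: cvg_cst. Qed.

Lemma sqint_integrable f (T : R) : sqint f -> 0 <= T ->
  mu.-integrable `[0, T] (EFin \o f).
Proof.
move=> hf T0; have := sqintM_integrable hf (sqint_cst 1) T0.
by apply: eq_integrable => // t _; rewrite /= mulr1.
Qed.

Lemma sqintD f g : sqint f -> sqint g -> sqint (fun t => f t + g t).
Proof.
move=> hf hg; split; first by apply: measurable_funD; [exact: hf.1|exact: hg.1].
move=> T T0.
have fg t : (f t + g t) ^+ 2 = f t ^+ 2 + (2 * (f t * g t) + g t ^+ 2) by ring.
apply: (eq_integrabler (fun t => esym (fg t))).
apply: integrable_addr => //; first exact: hf.2.
apply: integrable_addr => //; last exact: hg.2.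
by apply: integrable_mulr => //; exact: sqintM_integrable.
Qed.

Lemma sqintZ a f : sqint f -> sqint (fun t => a * f t).
Proof.
move=> hf; split; first by apply: measurable_funM => //; exact: hf.1.
move=> T T0; apply: (eq_integrabler (fun t => esym (exprMn _ _ _))).
by apply: integrable_mulr => //; exact: hf.2.
Qed.

Lemma sqint_sum (I : finType) (F : I -> R -> R) :
  (forall i, sqint (F i)) -> sqint (fun t => \sum_i F i t).
Proof.
move=> hF; elim: (index_enum I) => [|i s IH].
  by under eq_fun do rewrite big_nil; exact: sqint_cst.
by under eq_fun do rewrite big_cons; exact: sqintD.
Qed.

Section Signals.
Local Notation L2 := loc_square_integrable.

Lemma L2_mulmx p q (K : 'M[R]_(p, q)) u : L2 u -> L2 (fun t => K *m u t).
Proof.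
move=> hu i; rewrite -[_ /\ _]/(sqint _); under eq_fun do rewrite mxE.
by apply: sqint_sum => j; exact/sqintZ/hu.
Qed.

Lemma L2D q (u v : R -> 'cV[R]_q) : L2 u -> L2 v -> L2 (fun t => u t + v t).
Proof.
move=> hu hv i; rewrite -[_ /\ _]/(sqint _); under eq_fun do rewrite mxE.
by apply: sqintD; [exact: hu|exact: hv].
Qed.

Lemma L2Z q a (u : R -> 'cV[R]_q) : L2 u -> L2 (fun t => a *: u t).
Proof.
move=> hu i; rewrite -[_ /\ _]/(sqint _); under eq_fun do rewrite mxE.
by apply: sqintZ; exact: hu.
Qed.

Lemma L2_cst q (c : 'cV[R]_q) : L2 (fun=> c).
Proof. by move=> i; exact: sqint_cst. Qed.

Lemma L2_bform_integrable p q (M : 'M[R]_(p, q)) u v (T : R) : L2 u -> L2 v -> 0 <= T ->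
  mu.-integrable `[0, T] (fun t => (bform M (u t) (v t))%:E).
Proof.
move=> hu hv T0; apply: (eq_integrabler (fun t => esym (bformE _ _ _))).
apply: integrable_sumr => // i; apply: integrable_sumr => // j.
apply: integrable_mulr => //.
exact: sqintM_integrable.
Qed.

Lemma L2_bform_measurable p q (M : 'M[R]_(p, q)) u v : L2 u -> L2 v ->
  measurable_fun (`[0, +oo[ : set R) (fun t => bform M (u t) (v t)).
Proof.
move=> hu hv; rewrite (funext (fun t => bformE M (u t) (v t))).
apply: measurable_sum => i; apply: measurable_sum => j; apply: measurable_funM => //.
by apply: measurable_funM; [exact: (hu i).1|exact: (hv j).1].
Qed.

Lemma L2_shift q (u : R -> 'cV[R]_q) a : 0 <= a -> L2 u -> L2 (fun t => u (t + a)).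
Proof.
move=> a0 hu i; have [mu_ iu] := hu i; split.
  have := measurable_fun_translation (a := a) (measurable_itv _) mu_.
  rewrite preimage_addr_itvy sub0r; apply: measurable_funS => // t /=.
  by rewrite !in_itv/= !andbT; apply: le_trans; rewrite oppr_le0.
move=> T T0.
have := integrable_translation a (measurable_itv _) (iu (T + a) (addr_ge0 T0 a0)).
rewrite preimage_addr_itv sub0r addrK; apply: integrableS => // t /=.
by rewrite !in_itv/= => /andP[t0 ->]; rewrite andbT (le_trans _ t0)// oppr_le0.
Qed.

End Signals.
End SquareIntegrable.

(** * Linear differential equations *)

Section LinearODE.
Context {R : realType}.

Lemma is_derive_sumr (I : finType) (F : I -> R -> R) (dF : I -> R) (t : R) :
  (forall i, is_derive t (1 : R) (F i) (dF i)) ->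
  is_derive t (1 : R) (fun s => \sum_i F i s) (\sum_i dF i).
Proof.
move=> hF; elim: (index_enum I) => [|i s IH].
  rewrite big_nil; under eq_fun do rewrite big_nil; exact: is_derive_cst.
rewrite big_cons; under eq_fun do rewrite big_cons.
exact: (is_deriveD (hF i) IH).
Qed.

Lemma is_derive_bform m q (M : 'M[R]_(m, q)) (z : R -> 'cV[R]_m) (w : R -> 'cV[R]_q)
    (dz : 'cV[R]_m) (dw : 'cV[R]_q) (t : R) :
  (forall i, is_derive t (1 : R) (fun s => z s i 0) (dz i 0)) ->
  (forall i, is_derive t (1 : R) (fun s => w s i 0) (dw i 0)) ->
  is_derive t (1 : R) (fun s => bform M (z s) (w s)) (bform M dz (w t) + bform M (z t) dw).
Proof.
move=> hz hw; rewrite (funext (fun s => bformE M (z s) (w s))) !bformE -big_split /=.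
apply: is_derive_sumr => i; rewrite -big_split /=; apply: is_derive_sumr => j.
have := is_deriveZ (M i j) (is_deriveM (hz i) (hw j)).
by rewrite -!/(GRing.scale _ _) /GRing.scale /= => h; apply: is_derive_eq h _; ring.
Qed.

Lemma cvgn_sumr (I : finType) (u : I -> R^nat) (l : I -> R) :
  (forall i, u i @ \oo --> l i) -> (fun n => \sum_i u i n) @ \oo --> \sum_i l i.
Proof. by move=> ul; apply: cvg_big => //; exact: add_continuous. Qed.

Lemma limn_sum (I : finType) (u : I -> R^nat) : (forall i, cvgn (u i)) ->
  limn (fun n => \sum_i u i n) = \sum_i limn (u i).
Proof.
by move=> cu; apply/cvg_lim => //; exact: cvgn_sumr.
Qed.

Lemma pseries0 (c : R^nat) : limn (pseries c 0) = c 0%N.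
Proof.
apply/cvg_lim => //; rewrite -cvg_shiftS /=.
rewrite (_ : (fun n => _) = cst (c 0%N)); first exact: cvg_cst.
apply/funext => n; rewrite /pseries /series /= big_nat_recl// expr0 mulr1.
by rewrite big1 ?addr0// => k _; rewrite expr0n mulr0.
Qed.

(** The exponential series applied to x0, coordinate by coordinate, so that
    scalar power series suffice: the k-th coefficient is (M^k x0) i / k!, it is
    dominated by b a^k / k! with a and b the entrywise l1 norms of M and x0, and
    formal differentiation of the series amounts to multiplication by M. *)
Lemma linear_ode_solution n (M : 'M[R]_n) (x0 : 'cV[R]_n) :
  exists z : R -> 'cV[R]_n, z 0 = x0 /\
    forall t i, is_derive t (1 : R) (fun s => z s i 0) ((M *m z t) i 0).
Proof.
pose pw k := iter k (mulmx M) x0.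
pose c (i : 'I_n) : R^nat := fun k => pw k i 0 / k`!%:R.
pose a := \sum_i \sum_j `|M i j|; pose b := \sum_i `|x0 i 0|.
have a0 : 0 <= a by apply: sumr_ge0 => i _; exact: sumr_ge0.
have b0 : 0 <= b by exact: sumr_ge0.
have pwE k i : pw k.+1 i 0 = \sum_j M i j * pw k j 0 by rewrite /pw iterS mxE.
have pwB k i : `|pw k i 0| <= a ^+ k * b.
  elim: k i => [|k IH] i; first by rewrite expr0 mul1r /b (bigD1 i)//= lerDl sumr_ge0.
  rewrite pwE (le_trans (ler_norm_sum _ _ _))// exprS -mulrA.
  apply: (@le_trans _ _ (\sum_j `|M i j| * (a ^+ k * b))).
    by apply: ler_sum => j _; rewrite normrM ler_wpM2l.
  rewrite -mulr_suml ler_wpM2r ?mulr_ge0 ?exprn_ge0//.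
  rewrite /a [leRHS](bigD1 i)//= lerDl; apply: sumr_ge0 => *; exact: sumr_ge0.
have cvg_c i t : cvgn (pseries (c i) t).
  apply: normed_cvg; rewrite /normed_series_of.
  apply: (@series_le_cvg _ _ (fun k => b * exp_coeff (a * `|t|) k)) => [k|k|k|] //=.
  - by rewrite mulr_ge0 ?exp_coeff_ge0 ?mulr_ge0.
  - rewrite /c /exp_coeff /= normrM normrX normrM normfV normr_nat exprMn.
    rewrite [leLHS]mulrAC [leRHS]mulrA ler_wpM2r ?invr_ge0//.
    by rewrite mulrA [b * _]mulrC ler_wpM2r ?exprn_ge0.
  - rewrite (_ : (fun k => _) = b *: exp_coeff (a * `|t|))//.
    exact/is_cvg_seriesZ/is_cvg_series_exp_coeff.
have dE i : pseries_diffs (c i) = fun k => \sum_j M i j * c j k.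
  apply/funext => k; rewrite /pseries_diffs /c pwE factS natrM invfM.
  rewrite mulrCA [_%:R * _]mulrA mulfV ?pnatr_eq0// mul1r mulr_suml.
  by apply: eq_bigr => j _; rewrite mulrA.
have psE i (u : 'I_n -> R^nat) t : pseries (fun k => \sum_j M i j * u j k) t =
    (fun k => \sum_j M i j * pseries (u j) t k).
  apply/funext => k; rewrite /pseries /series /=.
  under eq_bigr do rewrite mulr_suml; rewrite exchange_big /=.
  by apply: eq_bigr => j _; rewrite mulr_sumr; apply: eq_bigr => l _; rewrite mulrA.
have cvg_sum i (u : 'I_n -> R^nat) t : (forall j, cvgn (pseries (u j) t)) ->
    cvgn (pseries (fun k => \sum_j M i j * u j k) t).
  move=> cu; rewrite psE; apply/cvg_ex; exists (\sum_j M i j * limn (pseries (u j) t)).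
  by apply: cvgn_sumr => j; apply: cvgMl_tmp; exact: cu.
have cvg_d i t : cvgn (pseries (pseries_diffs (c i)) t) by rewrite dE; exact: cvg_sum.
have cvg_dd i t : cvgn (pseries (pseries_diffs (pseries_diffs (c i))) t).
  rewrite dE (_ : pseries_diffs _ = fun k => \sum_j M i j * pseries_diffs (c j) k).
    exact: cvg_sum.
  by apply/funext => k; rewrite /pseries_diffs mulr_sumr; apply: eq_bigr => *; ring.
exists (fun t => \col_i limn (pseries (c i) t)); split.
  by apply/colP => i; rewrite mxE pseries0 /c fact0 divr1.
move=> t i; under eq_fun do rewrite mxE.
have tt : `|t| < `| `|t| + 1| by rewrite [ltRHS]ger0_norm ?ltrDl// addr_ge0.
have := pseries_snd_diffs (cvg_c i _) (cvg_d i _) (cvg_dd i _) tt.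
move=> h; apply: is_derive_eq h _; rewrite dE psE limn_sum => [|j].
  rewrite mxE; apply: eq_bigr => j _; rewrite mxE; apply/cvg_lim => //.
  by apply: cvgMl_tmp; exact: cvg_c.
by apply: is_cvgMl_tmp; exact: cvg_c.
Qed.

Lemma continuous_derive (F f : R -> R) :
  (forall t, is_derive t (1 : R) F (f t)) -> continuous F.
Proof.
by move=> dF t; apply: differentiable_continuous; apply/derivable1_diffP; have [] := dF t.
Qed.

Lemma Rintegral_derive (F f : R -> R) (T : R) :
  (forall t, is_derive t (1 : R) F (f t)) -> continuous f -> 0 <= T ->
  \int[@lebesgue_measure R]_(t in `[0, T]) f t = F T - F 0.
Proof.
move=> dF cf; rewrite le_eqVlt => /predU1P[<-|T0].
  by rewrite set_itv1 Rintegral_set1 subrr.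
rewrite /Rintegral (continuous_FTC2 (F := F)) => //.
- exact: continuous_subspaceT.
- have cF := continuous_derive dF; split => [t _||].
  + by have [] := dF t.
  + exact/cvg_at_right_filter/cF.
  + exact/cvg_at_left_filter/cF.
- by move=> t _; rewrite derive1E; have [] := dF t.
Qed.

End LinearODE.

(** * Trajectories of a linear system *)

Section Trajectories.
Context {R : realType}.
Local Notation mu := (@lebesgue_measure R).
Local Notation L2 := loc_square_integrable.

Section System.
Variables (m q : nat) (A : 'M[R]_m) (B : 'M[R]_(m, q)).

Lemma trajectory_within_continuous x0 u x i (T : R) : 0 <= T ->
  trajectory A B x0 u x -> {within `[0, T], continuous (fun t => x t i 0)}.
Proof.
move=> T0 tx; have [iT _] := tx T i T0.
have c := parameterized_integral_continuous T0 iT.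
pose g t := x0 i 0 + \int[mu]_(s in `[0, t]) ((A *m x s + B *m u s) i 0).
have cg : {within `[0, T], continuous g}.
  by move=> t; apply: (@continuousD _ _ (subspace `[0, T])); [exact: cst_continuous|exact: c].
refine (subspace_eq_continuous _ cg).
by move=> t /set_mem /=; rewrite in_itv/= => /andP[t0 _]; exact/esym/(tx t i t0).2.
Qed.

(** A state trajectory is continuous, being the integral of its velocity. *)
Lemma trajectory_L2 x0 u x : trajectory A B x0 u x -> L2 x.
Proof.
move=> tx i; apply: continuous_sqint => T T0.
exact: trajectory_within_continuous T0 tx.
Qed.

Definition admissible x0 x u := L2 u /\ trajectory A B x0 u x.

Lemma admissible_L2 x0 x u : admissible x0 x u -> L2 x /\ L2 u.
Proof. by move=> [hu /trajectory_L2]. Qed.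

Lemma L2_velocity x u : L2 x -> L2 u -> L2 (fun t => A *m x t + B *m u t).
Proof. by move=> hx hu; apply: L2D; exact: L2_mulmx. Qed.

Lemma admissibleP (x0 : 'cV[R]_m) x u : L2 u -> L2 x ->
  (forall t i, 0 <= t ->
     x t i 0 = x0 i 0 + \int[mu]_(s in `[0, t]) ((A *m x s + B *m u s) i 0)) ->
  admissible x0 x u.
Proof.
move=> hu hx xE; split=> // t i t0; split; last exact: xE.
exact: (sqint_integrable (L2_velocity hx hu i) t0).
Qed.

Lemma velocity_integrable x0 x u i t : admissible x0 x u -> 0 <= t ->
  mu.-integrable `[0, t] (fun s => ((A *m x s + B *m u s) i 0)%:E).
Proof. by move=> [_ tx] t0; have [] := tx t i t0. Qed.

Lemma admissibleE x0 x u t i : admissible x0 x u -> 0 <= t ->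
  x t i 0 = x0 i 0 + \int[mu]_(s in `[0, t]) ((A *m x s + B *m u s) i 0).
Proof. by move=> [_ tx] t0; have [] := tx t i t0. Qed.

Lemma admissible_init x0 x u : admissible x0 x u -> x 0 = x0.
Proof.
move=> ax; apply/colP => i.
by rewrite (admissibleE i ax (lexx 0)) set_itv1 Rintegral_set1 addr0.
Qed.

Lemma admissible_comb a b x0 y0 x y u v : admissible x0 x u -> admissible y0 y v ->
  admissible (a *: x0 + b *: y0) (fun t => a *: x t + b *: y t)
    (fun t => a *: u t + b *: v t).
Proof.
move=> ax ay; have [hx hu] := admissible_L2 ax; have [hy hv] := admissible_L2 ay.
apply: admissibleP; [by apply: L2D; exact: L2Z..|].
move=> t i t0; rewrite !mxE (admissibleE i ax t0) (admissibleE i ay t0).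
set f := fun s => (A *m x s + B *m u s) i 0; set g := fun s => (A *m y s + B *m v s) i 0.
have fi : mu.-integrable `[0, t] (EFin \o f) := velocity_integrable i ax t0.
have gi : mu.-integrable `[0, t] (EFin \o g) := velocity_integrable i ay t0.
have fgE s : (A *m (a *: x s + b *: y s) + B *m (a *: u s + b *: v s)) i 0 =
    a * f s + b * g s.
  by rewrite /f /g !mulmxDr -!scalemxAr !mxE; ring.
rewrite [RHS](_ : _ = a * x0 i 0 + b * y0 i 0 +
    \int[mu]_(s in `[0, t]) (a * f s + b * g s)); last first.
  by congr (_ + _); apply: eq_Rintegral => s _; exact: fgE.
rewrite RintegralD//; [|exact: integrable_mulr..].
by rewrite !RintegralZl//; ring.
Qed.

Lemma admissible_shift x0 x u a : 0 <= a -> admissible x0 x u ->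
  admissible (x a) (fun t => x (t + a)) (fun t => u (t + a)).
Proof.
move=> a0 ax; have [hx hu] := admissible_L2 ax.
apply: admissibleP; [exact: L2_shift..|] => t i t0.
have ta0 : 0 <= t + a by rewrite addr_ge0.
rewrite (admissibleE i ax ta0) (admissibleE i ax a0) -addrA; congr (_ + _).
set f := fun s => (A *m x s + B *m u s) i 0.
have fi : mu.-integrable `[0, t + a] (EFin \o f) := velocity_integrable i ax ta0.
apply/eqP; rewrite addrC -subr_eq; apply/eqP.
rewrite (Rintegral_itvB fi); [|by rewrite bnd_simp|by rewrite bnd_simp lerDr].
have mf : measurable_fun `[a, t + a] f.
  apply: measurable_funS (subset_trans _ (@subset_itv0y _ (t + a))) (L2_velocity hx hu i).1 => //.
  by apply: subset_itvr; rewrite bnd_simp.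
rewrite Rintegral_itv_obnd_cbnd; last first.
  by apply: integrableS fi => //; apply: subset_itv; rewrite bnd_simp.
by rewrite (Rintegral_translation a (measurable_itv _) mf) preimage_addr_itv subrr addrK.
Qed.

(** The derivative is recorded on the whole real line, including negative times,
    so that the fundamental theorem of calculus needs no one-sided limits. *)
Lemma admissible_closed_loop (K : 'M[R]_(q, m)) x0 : exists z : R -> 'cV[R]_m,
  (forall t i, is_derive t (1 : R) (fun s => z s i 0) (((A + B *m K) *m z t) i 0)) /\
  admissible x0 z (fun t => K *m z t).
Proof.
have [z [z0 dz]] := linear_ode_solution (A + B *m K) x0; exists z; split=> //.
have cz i : continuous (fun s => z s i 0).
  by apply: (@continuous_derive _ _ (fun t => ((A + B *m K) *m z t) i 0)) => t; exact: dz.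
have hz : L2 z.
  by move=> i; apply: continuous_sqint => T _; apply: continuous_subspaceT; exact: cz.
apply: admissibleP => //; first exact: L2_mulmx.
move=> t i t0; have cf : continuous (fun s => ((A + B *m K) *m z s) i 0).
  rewrite (_ : (fun s => _) = fun s => \sum_j (A + B *m K) i j * z s j 0); last first.
    by apply/funext => s; rewrite mxE.
  by apply: continuous_big => [|j _ s]; [exact: add_continuous|apply: cvgMl_tmp; exact: cz].
rewrite (@eq_Rintegral _ (measurableTypeR R) R mu _
  (fun s => ((A + B *m K) *m z s) i 0)) => [|s _]; last first.
  by rewrite mulmxDl mulmxA.
by rewrite (Rintegral_derive (F := fun s => z s i 0) (dz^~ i) cf t0) z0 addrC subrK.
Qed.

End System.

(** This covers both the insertion of one agent into the network and the
    synchronised motions of the whole network. *)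
Lemma admissible_intertwine m q m' q' (A : 'M[R]_m) (B : 'M[R]_(m, q)) (A' : 'M[R]_m')
    (B' : 'M[R]_(m', q')) (E : 'M[R]_(m', m)) (F : 'M[R]_(q', q)) x0 x u :
  A' *m E = E *m A -> B' *m F = E *m B -> admissible A B x0 x u ->
  admissible A' B' (E *m x0) (fun t => E *m x t) (fun t => F *m u t).
Proof.
move=> AE BF ax; have [hx hu] := admissible_L2 ax.
apply: admissibleP; [exact: L2_mulmx..|] => t i t0.
pose f j s := (A *m x s + B *m u s) j 0.
have fi j : mu.-integrable `[0, t] (EFin \o f j) := velocity_integrable j ax t0.
rewrite (@eq_Rintegral _ (measurableTypeR R) R mu _
  (fun s => \sum_j E i j * f j s)) => [|s _]; last first.
  by rewrite !mulmxA AE BF -!mulmxA -mulmxDr [LHS]mxE.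
rewrite Rintegral_sumr// => [|j]; last by apply: integrable_mulr => //; exact: fi.
rewrite !mxE -big_split /=; apply: eq_bigr => j _.
rewrite (admissibleE j ax t0) mulrDr; congr (_ + _).
rewrite -[LHS](@RintegralZl _ (measurableTypeR R) R mu _ (f j))//; exact: fi.
Qed.

End Trajectories.

(** * The cost and the value function *)

Section Cost.
Context {R : realType}.
Local Notation mu := (@lebesgue_measure R).
Local Notation L2 := loc_square_integrable.
Variables (m q : nat) (W : 'M[R]_m) (S : 'M[R]_q).

Definition running_cost (x : R -> 'cV[R]_m) (u : R -> 'cV[R]_q) t :=
  qform W (x t) + qform S (u t).

Lemma running_cost_measurable x u : L2 x -> L2 u ->
  measurable_fun (`[0, +oo[ : set R) (running_cost x u).
Proof. by move=> hx hu; apply: measurable_funD; exact: L2_bform_measurable. Qed.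

Lemma running_cost_integrable x u (T : R) : L2 x -> L2 u -> 0 <= T ->
  mu.-integrable `[0, T] (fun t => (running_cost x u t)%:E).
Proof. by move=> hx hu T0; apply: integrable_addr => //; exact: L2_bform_integrable. Qed.

Hypotheses (hW : possemidefmx W) (hS : possemidefmx S).

Lemma qformD_ge0 v w : 0 <= qform W v + qform S w.
Proof. by rewrite addr_ge0 ?hW.2 ?hS.2. Qed.

Lemma running_cost_ge0 x u t : 0 <= running_cost x u t.
Proof. exact: qformD_ge0. Qed.

Lemma cost_ge0 x u : (0 <= cost W S x u)%E.
Proof. by apply: integral_ge0 => t _; rewrite lee_fin running_cost_ge0. Qed.

Lemma cost_shift x u a : 0 <= a -> L2 x -> L2 u ->
  cost W S x u = ((\int[mu]_(t in `[0, a]) running_cost x u t)%:E +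
    cost W S (fun t => x (t + a)%R) (fun t => u (t + a)%R))%E.
Proof.
move=> a0 hx hu; have ml := running_cost_measurable hx hu.
have i0a := running_cost_integrable hx hu a0.
rewrite {1}/cost (@itv_bndbnd_setU _ _ _ (BRight a)) ?bnd_simp//.
have mS (b : bool) : measurable_fun [set` Interval (BSide b a) +oo%O] (running_cost x u).
  apply: measurable_funS ml => // t /=; rewrite !in_itv/= !andbT.
  by case: b => /=; [apply: le_trans|move=> /ltW; apply: le_trans].
rewrite ge0_integral_setU//=; last 3 first.
- rewrite -itv_bndbnd_setU ?bnd_simp//; exact/measurable_EFinP.
- by move=> t _; rewrite lee_fin running_cost_ge0.
- apply/disj_setPS => t [/=]; rewrite !in_itv/= andbT => /andP[_ ta].
  by rewrite ltNge ta.
congr (_ + _)%E.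
  by rewrite /Rintegral fineK//; exact: integrable_fin_num i0a.
rewrite integral_itv_obnd_cbnd; last exact/measurable_EFinP.
have mE : measurable_fun `[a, +oo[ (EFin \o running_cost x u) by exact/measurable_EFinP.
rewrite (ge0_integral_translation a (measurable_itv _) mE).
  by rewrite preimage_addr_itvy subrr; apply: eq_integral => t _.
by move=> t _; rewrite /= lee_fin running_cost_ge0.
Qed.

Lemma costZ a x u : L2 x -> L2 u ->
  cost W S (fun t => a *: x t) (fun t => a *: u t) = ((a ^+ 2)%:E * cost W S x u)%E.
Proof.
move=> hx hu; have ml := running_cost_measurable hx hu.
rewrite -ge0_integralZl_EFin ?sqr_ge0//.
- by apply: eq_integral => t _; rewrite !qformZ -EFinM mulrDr.
- by move=> t _; rewrite lee_fin running_cost_ge0.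
- exact/measurable_EFinP.
Qed.

Lemma cost_parallelogram x y u v : L2 x -> L2 y -> L2 u -> L2 v ->
  (cost W S (fun t => x t + y t)%R (fun t => u t + v t)%R +
   cost W S (fun t => x t - y t)%R (fun t => u t - v t)%R =
   2%:E * cost W S x u + 2%:E * cost W S y v)%E.
Proof.
move=> hx hy hu hv.
have L2B k (f g : R -> 'cV[R]_k) : L2 f -> L2 g -> L2 (fun t => f t - g t).
  move=> hf hg; rewrite (_ : (fun t => _) = fun t => f t + (-1) *: g t).
    by apply: L2D => //; exact: L2Z.
  by apply/funext => t; rewrite scaleN1r.
have mD := running_cost_measurable (L2D hx hy) (L2D hu hv).
have mB := running_cost_measurable (L2B _ _ _ hx hy) (L2B _ _ _ hu hv).
have mx := running_cost_measurable hx hu.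
have my := running_cost_measurable hy hv.
rewrite /cost -ge0_integralD//; last 4 first.
- by move=> t _; rewrite lee_fin qformD_ge0.
- exact/measurable_EFinP.
- by move=> t _; rewrite lee_fin qformD_ge0.
- exact/measurable_EFinP.
rewrite -!ge0_integralZl_EFin//; last 4 first.
- by move=> t _; rewrite lee_fin qformD_ge0.
- exact/measurable_EFinP.
- by move=> t _; rewrite lee_fin qformD_ge0.
- exact/measurable_EFinP.
rewrite -ge0_integralD//; last 4 first.
- by move=> t _; rewrite mule_ge0// lee_fin qformD_ge0.
- by apply: measurable_funeM; exact/measurable_EFinP.
- by move=> t _; rewrite mule_ge0// lee_fin qformD_ge0.
- by apply: measurable_funeM; exact/measurable_EFinP.
apply: eq_integral => t _; rewrite -!EFinM -!EFinD; congr EFin.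
have := qform_parallelogram W (x t) (y t).
have := qform_parallelogram S (u t) (v t).
lra.
Qed.

Variables (A : 'M[R]_m) (B : 'M[R]_(m, q)).
Local Notation adm := (admissible A B).

Definition value (x0 : 'cV[R]_m) : R :=
  inf [set r | exists x u, adm x0 x u /\ cost W S x u = r%:E].

Hypothesis finite_cost : forall x0, exists x u, adm x0 x u /\ (cost W S x u < +oo)%E.

Let has_inf_cost x0 : has_inf [set r | exists x u, adm x0 x u /\ cost W S x u = r%:E].
Proof.
split.
  have [x [u [ax cx]]] := finite_cost x0.
  by exists (fine (cost W S x u)), x, u; rewrite fineK ?ge0_fin_numE ?cost_ge0.
by exists 0 => r [x [u [_ cr]]]; rewrite -lee_fin -cr cost_ge0.
Qed.

Lemma value_le x0 x u : adm x0 x u -> ((value x0)%:E <= cost W S x u)%E.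
Proof.
move=> ax; have := cost_ge0 x u; case cr: (cost W S x u) => [r| |] // _; last exact: leey.
by rewrite lee_fin; apply: ge_inf; [exact: (has_inf_cost x0).2|exists x, u].
Qed.

Lemma value_approx x0 e : 0 < e ->
  exists x u, adm x0 x u /\ (cost W S x u <= (value x0 + e)%:E)%E.
Proof.
move=> e0; have [r [x [u [ax cr]]] re] := inf_adherent e0 (has_inf_cost x0).
by exists x, u; split=> //; rewrite cr lee_fin ltW.
Qed.

Lemma value_ge0 x0 : 0 <= value x0.
Proof.
apply: lb_le_inf; first exact: (has_inf_cost x0).1.
by move=> r [x [u [_ cr]]]; rewrite -lee_fin -cr cost_ge0.
Qed.

(* Only an inequality can be read off nearly optimal trajectories; replacing a
   by its inverse gives the other one. *)
Let valueZ_le a x0 : value (a *: x0) <= a ^+ 2 * value x0.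
Proof.
apply/ler_addgt0Pr => e e0.
have a1 : 0 < a ^+ 2 + 1 by rewrite ltr_pwDr// sqr_ge0.
have [x [u [ax cx]]] := value_approx x0 (divr_gt0 e0 a1).
have [hx hu] := admissible_L2 ax.
have := value_le (admissible_comb a 0 ax ax); rewrite scale0r addr0.
rewrite (_ : (fun t => _) = fun t => a *: x t); last first.
  by apply/funext => t; rewrite scale0r addr0.
rewrite (_ : (fun t => _ *: u t + _) = fun t => a *: u t); last first.
  by apply/funext => t; rewrite scale0r addr0.
rewrite costZ// => /le_trans/(_ (lee_wpmul2l _ cx)); rewrite lee_fin sqr_ge0 => /(_ isT).
rewrite -EFinM lee_fin mulrDr => /le_trans; apply; rewrite lerD2l.
by rewrite mulrCA ler_piMr ?(ltW e0)// ler_pdivrMr// mul1r lerDl.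
Qed.

Lemma valueZ a x0 : value (a *: x0) = a ^+ 2 * value x0.
Proof.
apply/eqP; rewrite eq_le valueZ_le /=; have [->|a0] := eqVneq a 0.
  by rewrite expr0n mul0r value_ge0.
have := valueZ_le a^-1 (a *: x0); rewrite scalerA mulVf// scale1r exprVn.
by rewrite ler_pdivlMl// exprn_even_gt0.
Qed.

(* The converse inequality is this one at x0 + y0 and x0 - y0. *)
Let value_parallelogram_le x0 y0 :
  value (x0 + y0) + value (x0 - y0) <= 2 * value x0 + 2 * value y0.
Proof.
apply/ler_addgt0Pr => e e0; have e4 : 0 < e / 4 by rewrite divr_gt0.
have [x [u [ax cx]]] := value_approx x0 e4.
have [y [v [ay cy]]] := value_approx y0 e4.
have [hx hu] := admissible_L2 ax; have [hy hv] := admissible_L2 ay.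
have := admissible_comb 1 1 ax ay; have := admissible_comb 1 (-1) ax ay.
have e1 k (f g : R -> 'cV[R]_k) : (fun t => 1 *: f t + 1 *: g t) = fun t => f t + g t.
  by apply/funext => t; rewrite !scale1r.
have e2 k (f g : R -> 'cV[R]_k) : (fun t => 1 *: f t + (-1) *: g t) = fun t => f t - g t.
  by apply/funext => t; rewrite scale1r scaleN1r.
rewrite !e1 !e2 !scale1r scaleN1r => /value_le hB /value_le hD.
have := leeD hD hB; rewrite cost_parallelogram// => h.
have two0 : (0 <= 2%:E :> \bar R)%E by rewrite lee_fin.
have := le_trans h (leeD (lee_wpmul2l two0 cx) (lee_wpmul2l two0 cy)).
rewrite -!EFinM -!EFinD lee_fin; lra.
Qed.

Lemma value_parallelogram x0 y0 :
  value (x0 + y0) + value (x0 - y0) = 2 * value x0 + 2 * value y0.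
Proof.
apply/eqP; rewrite eq_le value_parallelogram_le /=.
have := value_parallelogram_le (x0 + y0) (x0 - y0).
have -> : x0 + y0 + (x0 - y0) = 2 *: x0 by rewrite addrACA subrr addr0 scaler_nat.
have -> : x0 + y0 - (x0 - y0) = 2 *: y0.
  by rewrite opprB addrC addrA subrK scaler_nat.
by rewrite !valueZ; lra.
Qed.

Lemma value_qform : exists P, possemidefmx P /\ value = qform P.
Proof.
by apply: jordan_von_neumann; [exact: value_ge0|exact: valueZ|exact: value_parallelogram].
Qed.

End Cost.

(** * Short-time estimate of the state *)

Section RiccatiInequality.
Context {R : realType}.
Local Notation mu := (@lebesgue_measure R).
Local Notation L2 := loc_square_integrable.
Variables (m q : nat) (A : 'M[R]_m) (B : 'M[R]_(m, q)) (W : 'M[R]_m) (S : 'M[R]_q).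
Hypotheses (hW : possemidefmx W) (hS : posdefmx S).
Local Notation adm := (admissible A B).

Let hS0 : possemidefmx S := posdefmx_possemidef hS.
Let Su : S \in unitmx := posdefmx_unit hS.

Lemma trmx_invmx_posdef : (invmx S)^T = invmx S.
Proof. by rewrite trmx_inv hS.1. Qed.

(** The left-hand side is the minimum over u, attained at u = - S^-1 L^T w. *)
Lemma complete_square p (L : 'M[R]_(p, q)) (w : 'cV[R]_p) (u : 'cV[R]_q) :
  - qform (L *m invmx S *m L^T) w <= qform S u + 2 * bform L w u.
Proof.
have := hS0.2 (u + invmx S *m (L^T *m w)).
rewrite (qformD _ _ hS.1) !bform_mulr mulmxV// mul1mx bform_trmx.
by rewrite !qform_mul trmx_invmx_posdef mulVmx// mul1mx trmxK; lra.
Qed.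

Let G := B *m invmx S *m B^T.

(** Weighted arithmetic-geometric inequality in the norm given by S.  It bounds
    the velocity due to the input by the control energy without comparing S with
    the Euclidean norm. *)
Lemma input_velocity_le s i u : 0 < s ->
  `|(B *m u) i 0| <= s / 2 * qform S u + G i i / 2 / s.
Proof.
move=> s0; pose e : 'cV[R]_m := delta_mx i 0.
have eB : bform B e u = (B *m u) i 0.
  by rewrite /bform -mulmxA trmx_delta -rowE mxE.
have eG : qform G e = G i i.
  by rewrite /qform trmx_delta -rowE -colE !mxE.
have h1 := complete_square B e (s *: u); have h2 := complete_square B e (- (s *: u)).
move: h1 h2; rewrite -scaleNr !bformZr !qformZ -/G eB eG sqrrN.
set b := (B *m u) i 0; set c := qform S u; set g := G i i => h1 h2.
have -> : s / 2 * c + g / 2 / s = (s ^+ 2 * c + g) / 2 / s by field; rewrite gt_eqF.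
by rewrite ler_norml; apply/andP; split; [rewrite lerNl|];
  rewrite ler_pdivlMr// ler_pdivlMr//; lra.
Qed.

Definition deviation (x0 : 'cV[R]_m) (x : R -> 'cV[R]_m) t := \sum_j `|x t j 0 - x0 j 0|.

Lemma deviation_integrable (x0 : 'cV[R]_m) x t : L2 x -> 0 <= t ->
  mu.-integrable `[0, t] (fun r => (deviation x0 x r)%:E).
Proof.
move=> hx t0; apply: integrable_sumr => // j.
apply: (@integrable_norm _ _ _ mu _ (fun r => x r j 0 - x0 j 0)).
apply: (sqint_integrable (f := fun r => x r j 0 + (- x0 j 0))) => //.
by apply: sqintD; [exact: hx|exact: sqint_cst].
Qed.

Lemma Rintegral_itv0_cst (c t : R) : 0 <= t -> \int[mu]_(r in `[0, t]) c = c * t.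
Proof.
move=> t0; rewrite Rintegral_cst//= lebesgue_measure_itv/= lte_fin.
by move: t0; rewrite le_eqVlt => /predU1P[<-|->]; rewrite ?ltxx//= oppr0 addr0.
Qed.

Lemma velocity_l1_le x0 (x : R -> 'cV[R]_m) (u : R -> 'cV[R]_q) s r : 0 < s ->
  \sum_i `|(A *m x r + B *m u r) i 0| <=
  (\sum_i `|(A *m x0) i 0| + (\sum_i G i i) / 2 / s) +
  ((\sum_i \sum_j `|A i j|) * deviation x0 x r + m%:R * (s / 2) * qform S (u r)).
Proof.
move=> s0; set y := x r - x0.
have yE : A *m x r = A *m x0 + A *m y by rewrite -mulmxDr /y addrC subrK.
have Ay : \sum_i `|(A *m y) i 0| <= (\sum_i \sum_j `|A i j|) * deviation x0 x r.
  rewrite mulr_suml; apply: ler_sum => i _; rewrite mxE (le_trans (ler_norm_sum _ _ _))//.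
  rewrite mulr_suml; apply: ler_sum => j _; rewrite normrM ler_wpM2l//.
  by rewrite /y !mxE /deviation (bigD1 j)//= lerDl sumr_ge0.
have Bu : \sum_i `|(B *m u r) i 0| <=
    m%:R * (s / 2) * qform S (u r) + (\sum_i G i i) / 2 / s.
  rewrite !mulr_suml -mulrA -[m in m%:R]card_ord mulr_natl -sumr_const -big_split /=.
  by apply: ler_sum => i _; exact: input_velocity_le.
apply: (@le_trans _ _ (\sum_i (`|(A *m x0) i 0| + `|(A *m y) i 0| + `|(B *m u r) i 0|))).
  apply: ler_sum => i _; rewrite yE !mxE.
  by rewrite (le_trans (ler_normD _ _))// lerD2r ler_normD.
by rewrite !big_split /=; lra.
Qed.

(** On the time interval [0, s^2] the deviation has integral O(s^3), which is
    o(s^2).  It never exceeds the integral of the velocity, in which the weight s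
    balances the energy term, of size s E, against the remainder s^2 / s; the
    term proportional to the deviation itself is absorbed on the left for small
    s. *)
Lemma deviation_l1_le x0 x u s E : adm x0 x u -> 0 < s <= 1 ->
    s * (\sum_i \sum_j `|A i j|) <= 2^-1 ->
    \int[mu]_(r in `[0, s ^+ 2]) qform S (u r) <= E ->
  \int[mu]_(r in `[0, s ^+ 2]) deviation x0 x r <=
    2 * s ^+ 3 * (\sum_i `|(A *m x0) i 0| + (\sum_i G i i) / 2 + m%:R / 2 * E).
Proof.
move=> ax /andP[s0 s1] sA hE; set t := s ^+ 2; have [hx hu] := admissible_L2 ax.
have t0 : 0 <= t by rewrite sqr_ge0.
set a := \sum_i \sum_j _ in sA; set k := \sum_i `|_|; set g := \sum_i G i i.
have a0 : 0 <= a by apply: sumr_ge0 => i _; exact: sumr_ge0.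
have k0 : 0 <= k by exact: sumr_ge0.
set J := \int[mu]_(r in _) _; set c := \int[mu]_(r in _) _ in hE.
have idev := deviation_integrable x0 hx t0.
have iS := L2_bform_integrable S hu hu t0.
have iv i : mu.-integrable `[0, t] (fun r => (`|(A *m x r + B *m u r) i 0|)%:E).
  exact: (integrable_norm (velocity_integrable i ax t0)).
have dev_le r : 0 <= r <= t ->
    deviation x0 x r <= (k + g / 2 / s) * t + (a * J + m%:R * (s / 2) * c).
  move=> /andP[r0 rt].
  apply: (@le_trans _ _ (\int[mu]_(r in `[0, t]) \sum_i `|(A *m x r + B *m u r) i 0|)).
    rewrite Rintegral_sumr//; apply: ler_sum => i _.
    rewrite (admissibleE i ax r0) addrC addKr.
    have ir := velocity_integrable i ax r0.
    apply: (le_trans (le_normr_Rintegral _ ir)) => //.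
    rewrite -[leRHS](subrK (\int[mu]_(r in `[0, r]) `|(A *m x r + B *m u r) i 0|)).
    rewrite lerDr (Rintegral_itvB (iv i)) ?bnd_simp//.
    by apply: Rintegral_ge0.
  have i1 : mu.-integrable `[0, t] (fun r => (a * deviation x0 x r)%:E).
    exact: integrable_mulr.
  have i2 : mu.-integrable `[0, t] (fun r => (m%:R * (s / 2) * qform S (u r))%:E).
    exact: integrable_mulr.
  have i3 : mu.-integrable `[0, t] (fun r => (k + g / 2 / s)%:E).
    exact: (sqint_integrable (sqint_cst _)).
  have i12 := integrable_addr (measurable_itv _) i1 i2.
  rewrite -(Rintegral_itv0_cst _ t0) -RintegralZl// -[X in _ + (_ + X)]RintegralZl//.
  rewrite -RintegralD// -RintegralD//.
  apply: le_Rintegral => //.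
  - exact: integrable_sumr.
  - exact: (integrable_addr _ i3 i12).
  - by move=> r' _; exact: velocity_l1_le.
have : J <= ((k + g / 2 / s) * t + (a * J + m%:R * (s / 2) * c)) * t.
  rewrite -(Rintegral_itv0_cst _ t0); apply: le_Rintegral => //.
    exact: (sqint_integrable (sqint_cst _)).
have J0 : 0 <= J by apply: Rintegral_ge0 => r _; exact: sumr_ge0.
have -> : ((k + g / 2 / s) * t + (a * J + m%:R * (s / 2) * c)) * t =
    s ^+ 4 * k + s ^+ 3 * (g / 2) + s * (s * a) * J + s ^+ 3 * (m%:R / 2 * c).
  by rewrite /t; field; rewrite gt_eqF.
have s4k : s ^+ 4 * k <= s ^+ 3 * k.
  by rewrite ler_wpM2r// exprS ler_piMl// exprn_ge0// ltW.
have saJ : s * (s * a) * J <= 2^-1 * J.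
  rewrite ler_wpM2r//; apply: le_trans sA; rewrite ler_piMl// mulr_ge0//; exact: ltW.
have cE : s ^+ 3 * (m%:R / 2 * c) <= s ^+ 3 * (m%:R / 2 * E).
  by rewrite ler_wpM2l ?(exprn_ge0 _ (ltW s0))// ler_wpM2l// divr_ge0.
by rewrite -mulrA !mulrDr; lra.
Qed.

End RiccatiInequality.

(** * The Riccati inequality and the optimal feedback *)

Section Feedback.
Context {R : realType}.
Local Notation mu := (@lebesgue_measure R).
Local Notation L2 := loc_square_integrable.
Variables (m q : nat) (A : 'M[R]_m) (B : 'M[R]_(m, q)) (W : 'M[R]_m) (S : 'M[R]_q).
Hypotheses (hW : possemidefmx W) (hS : posdefmx S).
Local Notation adm := (admissible A B).
Local Notation V := (value W S A B).
Hypothesis finite_cost : forall x0, exists x u, adm x0 x u /\ (cost W S x u < +oo)%E.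

Let hS0 : possemidefmx S := posdefmx_possemidef hS.
Let Su : S \in unitmx := posdefmx_unit hS.

(** Dynamic programming: the tail after time t of a nearly optimal trajectory
    costs at least the value at its state at time t. *)
Lemma near_optimal_split x0 t e : 0 <= t -> 0 < e -> exists x u, adm x0 x u /\
  \int[mu]_(r in `[0, t]) running_cost W S x u r + V (x t) <= V x0 + e.
Proof.
move=> t0 e0; have [x [u [ax cx]]] := value_approx hW hS0 finite_cost x0 e0.
exists x, u; split=> //; have [hx hu] := admissible_L2 ax.
have := value_le hW hS0 finite_cost (admissible_shift t0 ax).
move: cx; rewrite (cost_shift hW hS0 t0 hx hu) => cx vx.
by have := le_trans (leeD2l _ vx) cx; rewrite -EFinD lee_fin.
Qed.

Variable P : 'M[R]_m.
Hypotheses (hP : possemidefmx P) (VP : V = qform P).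

Definition riccati_residual :=
  A^T *m P + P *m A + W - P *m B *m invmx S *m (P *m B)^T.

(** The right-hand side is the running cost plus the velocity of the linearisation
    of x^T P x at x0.  The terms in x are bounded below by their linearisations
    at x0, and the terms in u by completing the square. *)
Lemma linearised_cost_ge x0 (x : 'cV[R]_m) (u : 'cV[R]_q) :
  qform riccati_residual x0 -
    2 * (\sum_j `|((W + P *m A)^T *m x0) j 0|) * (\sum_j `|x j 0 - x0 j 0|)
  <= qform W x + qform S u + 2 * bform P x0 (A *m x + B *m u).
Proof.
set y := x - x0; have xE : x = x0 + y by rewrite /y addrC subrK.
set k := \sum_j _; set Y := \sum_j _.
have bY : - (k * Y) <= bform (W + P *m A) x0 y.
  have -> : bform (W + P *m A) x0 y = \sum_j ((W + P *m A)^T *m x0) j 0 * y j 0.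
    rewrite -bform_trmx /bform -mulmxA mxE.
    by apply: eq_bigr => j _; rewrite mxE mulrC.
  suff : `|\sum_j ((W + P *m A)^T *m x0) j 0 * y j 0| <= k * Y.
    by rewrite ler_norml => /andP[].
  rewrite (le_trans (ler_norm_sum _ _ _))// mulr_suml; apply: ler_sum => j _.
  rewrite normrM ler_wpM2l// /Y (bigD1 j)//= /y !mxE.
  by rewrite lerDl sumr_ge0.
have hu := complete_square hS (P *m B) x0 u.
have AP : qform (A^T *m P) x0 = bform (P *m A) x0 x0.
  by rewrite -bform_qform -bform_trmx trmx_mul hP.1 trmxK.
have Dq : qform riccati_residual x0 = 2 * bform (P *m A) x0 x0 + qform W x0 -
    qform (P *m B *m invmx S *m (P *m B)^T) x0.
  by rewrite /riccati_residual !(qformDm, qformNm) AP -bform_qform; ring.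
have Wx : qform W x = qform W x0 + 2 * bform W x0 y + qform W y.
  by rewrite xE (qformD _ _ hW.1).
have Px : bform P x0 (A *m x + B *m u) =
    bform (P *m A) x0 x0 + bform (P *m A) x0 y + bform (P *m B) x0 u.
  by rewrite bformDr !bform_mulr {1}xE bformDr.
move: bY; rewrite bformDm => bY; have Wy := hW.2 y.
by rewrite Dq Wx Px; lra.
Qed.

(** With t = s^2 and a trajectory optimal up to s^3, integrating
    [linearised_cost_ge] over [0, t] and using [deviation_l1_le] leaves
    t * d <= O(s^3); divide by t and let s tend to 0. *)
Lemma riccati_residual_le0 x0 : qform riccati_residual x0 <= 0.
Proof.
set d := qform _ _.
set a := \sum_i \sum_j `|A i j|.
pose k := \sum_j `|((W + P *m A)^T *m x0) j 0|.
(* Bounds the control energy of a trajectory that is optimal up to s^3 <= 1. *)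
pose E := V x0 + 1.
pose C := \sum_i `|(A *m x0) i 0| + (\sum_i (B *m invmx S *m B^T) i i) / 2 + m%:R / 2 * E.
have key s : 0 < s <= 1 -> s * a <= 2^-1 -> d <= s * (1 + 4 * k * C).
  move=> /andP[s0 s1] sa; pose t := s ^+ 2.
  have t0 : 0 < t by rewrite exprn_gt0.
  have s3 : 0 < s ^+ 3 by rewrite exprn_gt0.
  have [x [u [ax hxu]]] := near_optimal_split x0 (ltW t0) s3.
  have [hx hu] := admissible_L2 ax.
  have il := running_cost_integrable W S hx hu (ltW t0).
  have iS := L2_bform_integrable S hu hu (ltW t0).
  have iv := L2_bform_integrable P (L2_cst x0) (L2_velocity A B hx hu) (ltW t0).
  have idev := deviation_integrable x0 hx (ltW t0).
  have hE : \int[mu]_(r in `[0, t]) qform S (u r) <= E.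
    apply: (@le_trans _ _ (\int[mu]_(r in `[0, t]) running_cost W S x u r)).
      by apply: le_Rintegral => // r _; rewrite lerDr hW.2.
    have := value_ge0 hW hS0 finite_cost (x t).
    have : s ^+ 3 <= 1 by rewrite exprn_ile1// ltW.
    by move: hxu; rewrite /E; lra.
  have s01 : 0 < s <= 1 by rewrite s0.
  have hJ := deviation_l1_le hS ax s01 sa hE.
  rewrite -/t in hJ; set J := \int[mu]_(r in _) deviation _ _ _ in hJ.
  have Pxt : bform P x0 (x t - x0) =
      \int[mu]_(r in `[0, t]) bform P x0 (A *m x r + B *m u r).
    have bE (w : 'cV[R]_m) : bform P x0 w = \sum_i (x0^T *m P) 0 i * w i 0.
      by rewrite /bform mxE.
    rewrite bE (@eq_Rintegral _ (measurableTypeR R) R mu _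
      (fun r => \sum_i (x0^T *m P) 0 i * (A *m x r + B *m u r) i 0));
      last by move=> r _; exact: bE.
    have ivi i := velocity_integrable i ax (ltW t0).
    rewrite Rintegral_sumr// => [|i]; last by apply: integrable_mulr => //; exact: ivi.
    apply: eq_bigr => i _; rewrite RintegralZl//; last exact: ivi.
    by congr (_ * _); rewrite mxE [X in _ + X]mxE (admissibleE i ax (ltW t0)) addrC addKr.
  have Vxt : V x0 + 2 * bform P x0 (x t - x0) <= V (x t).
    rewrite VP -[in leRHS](subrK x0 (x t)) [x t - x0 + x0]addrC (qformD _ _ hP.1).
    by rewrite lerDl hP.2.
  have main : d * t - 2 * k * J <= s ^+ 3.
    have i2v : mu.-integrable `[0, t]
        (fun r => (2 * bform P x0 (A *m x r + B *m u r))%:E).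
      exact: integrable_mulr.
    have i2k : mu.-integrable `[0, t] (fun r => (- (2 * k) * deviation x0 x r)%:E).
      exact: integrable_mulr.
    have id : mu.-integrable `[0, t] (fun r : R => d%:E).
      exact: (sqint_integrable (sqint_cst _) (ltW t0)).
    have : \int[mu]_(r in `[0, t]) (d + - (2 * k) * deviation x0 x r) <=
        \int[mu]_(r in `[0, t]) (running_cost W S x u r + 2 * bform P x0 (A *m x r + B *m u r)).
      apply: le_Rintegral => //; [exact: integrable_addr|exact: integrable_addr|].
      by move=> r _; rewrite mulNr; exact: linearised_cost_ge.
    rewrite RintegralD// [leRHS]RintegralD// !RintegralZl// Rintegral_itv0_cst ?(ltW t0)// -Pxt -/J.
    by move: hxu Vxt; lra.
  have k0 : 0 <= k by exact: sumr_ge0.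
  have : d * t <= s ^+ 3 * (1 + 4 * k * C).
    have := ler_wpM2l (mulr_ge0 (ler0n R 2) k0) hJ.
    by move: main; rewrite -/C; lra.
  rewrite /t (_ : s ^+ 3 * _ = s * (1 + 4 * k * C) * s ^+ 2); last by ring.
  by rewrite ler_pM2r.
rewrite leNgt; apply/negP => d0.
have a0 : 0 <= a by apply: sumr_ge0 => i _; exact: sumr_ge0.
set c := 1 + 4 * k * C in key.
have c0 : 0 < `|c| + 1 by rewrite ltr_wpDl.
have a1 : 0 < 2 * (a + 1) by rewrite mulr_gt0// ltr_wpDl.
(* The two bounds make [key] applicable and its conclusion contradict 0 < d. *)
pose s := Num.min (2 * (a + 1))^-1 (d / 2 / (`|c| + 1)).
have s0 : 0 < s by rewrite lt_min invr_gt0 a1 !divr_gt0.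
have sa : s * (2 * (a + 1)) <= 1 by rewrite -ler_pdivlMr// div1r ge_min lexx.
have sc : s * (`|c| + 1) <= d / 2 by rewrite -ler_pdivlMr// ge_min lexx orbT.
have sa0 : 0 <= s * a by rewrite mulr_ge0// ltW.
have s01 : 0 < s <= 1 by rewrite s0 /=; lra.
have : s * a <= 2^-1 by lra.
move=> /(key _ s01).
have : s * c <= s * `|c| by rewrite ler_wpM2l ?(ltW s0)// ler_norm.
lra.
Qed.

Definition riccati_gain := - (invmx S *m (P *m B)^T).

(** With the gain substituted, the derivative of z^T P z is z^T D z minus the
    running cost, where D is [riccati_residual]; conclude by D <= 0. *)
Lemma closed_loop_decay (z : 'cV[R]_m) :
  qform W z + qform S (riccati_gain *m z) <=
  - (bform P ((A + B *m riccati_gain) *m z) z + bform P z ((A + B *m riccati_gain) *m z)).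
Proof.
have Kq : qform S (riccati_gain *m z) = qform (P *m B *m invmx S *m (P *m B)^T) z.
  rewrite /riccati_gain mulNmx -scaleN1r qformZ sqrrN expr1n mul1r qform_mul.
  by rewrite trmx_mul trmxK (trmx_invmx_posdef hS) mulmxKV// mulmxA.
have PB : bform P z ((B *m riccati_gain) *m z) = - qform (P *m B *m invmx S *m (P *m B)^T) z.
  by rewrite bform_mulr /riccati_gain !mulmxN bformNm !mulmxA.
have PA : bform P z (A *m z) = bform (P *m A) z z by rewrite bform_mulr.
rewrite (bformC _ z hP.1) mulmxDl bformDr PB PA Kq.
have := riccati_residual_le0 z; rewrite /riccati_residual !(qformDm, qformNm).
have -> : qform (A^T *m P) z = bform (P *m A) z z.
  by rewrite -bform_qform -bform_trmx trmx_mul hP.1 trmxK.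
by rewrite -(bform_qform (P *m A)); lra.
Qed.

(** Integrating [closed_loop_decay] over [0, T] bounds the cost up to T by
    V x0 - V (z T), and V (z T) >= 0 whatever the behaviour of z at infinity. *)
Lemma closed_loop_cost x0 : exists z,
  adm x0 z (fun t => riccati_gain *m z t) /\
  (cost W S z (fun t => riccati_gain *m z t)%R <= (V x0)%:E)%E.
Proof.
have [z [dz az]] := admissible_closed_loop A B riccati_gain x0.
exists z; split=> //; set l := running_cost W S z (fun t => riccati_gain *m z t).
have cz i : continuous (fun s => z s i 0).
  by apply: (@continuous_derive _ _ (fun t => ((A + B *m riccati_gain) *m z t) i 0)) => t;
    exact: dz.
have cb (M : 'M[R]_m) : continuous (fun s => bform M (z s) (z s)).
  rewrite (funext (fun s => bformE M (z s) (z s))).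
  apply: continuous_big => [|i _]; first exact: add_continuous.
  apply: continuous_big => [|j _ s]; first exact: add_continuous.
  by apply: cvgMl_tmp; apply: cvgM; exact: cz.
have cl : continuous l.
  rewrite (_ : l = fun s => bform W (z s) (z s) +
      bform (riccati_gain^T *m S *m riccati_gain) (z s) (z s)).
    by move=> s; apply: cvgD; exact: cb.
  by apply/funext => s; rewrite /l /running_cost qform_mul.
have l0 s : 0 <= l s := running_cost_ge0 hW hS0 _ _ s.
rewrite -[leLHS]/(\int[mu]_(t in `[0%R, +oo[) (l t)%:E)%E.
rewrite ge0_integral_ereal_sup//; last exact: continuous_measurable_fun.
apply: ge_ereal_sup => _ [n _ <-].
set T := n.+1%:R; have T0 : 0 <= T by exact: ler0n.
have [hz hu] := admissible_L2 az.
have il := running_cost_integrable W S hz hu T0.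
rewrite -[leLHS]fineK; last exact: integrable_fin_num il.
rewrite lee_fin -/(Rintegral mu _ _).
pose M := (A + B *m riccati_gain)^T *m P + P *m (A + B *m riccati_gain).
have ME s : bform P ((A + B *m riccati_gain) *m z s) (z s) +
    bform P (z s) ((A + B *m riccati_gain) *m z s) = bform M (z s) (z s).
  by rewrite bform_mull bform_mulr bformDm.
have := Rintegral_derive (F := fun s => qform P (z s)) (f := fun s => bform M (z s) (z s))
  _ (cb M) T0.
rewrite (admissible_init az) => /(_ _) h.
have {}h : \int[mu]_(t in `[0, T]) bform M (z t) (z t) = qform P (z T) - qform P x0.
  apply: h => t; rewrite -ME; apply: is_derive_bform => i; exact: dz.
have iM := L2_bform_integrable M hz hz T0.
apply: (@le_trans _ _ (\int[mu]_(t in `[0, T]) (-1 * bform M (z t) (z t)))).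
  apply: le_Rintegral => //; first exact: integrable_mulr.
  by move=> t _; rewrite mulN1r -ME; exact: closed_loop_decay.
by rewrite RintegralZl// h VP; have := hP.2 (z T); lra.
Qed.

End Feedback.

Section OptimalFeedback.
Context {R : realType}.
Variables (m q : nat) (A : 'M[R]_m) (B : 'M[R]_(m, q)) (W : 'M[R]_m) (S : 'M[R]_q).

(** The second property holds because a vanishing cost forces x0^T P x0 = 0, hence
    P x0 = 0, and the gain factors through P. *)
Lemma exists_optimal_feedback : possemidefmx W -> posdefmx S ->
  (forall x0, exists x u, admissible A B x0 x u /\ (cost W S x u < +oo)%E) ->
  exists K : 'M[R]_(q, m), optimal_feedback A B W S K /\
    forall x0 x u, admissible A B x0 x u -> cost W S x u = 0%E -> K *m x0 = 0.
Proof.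
move=> hW hS fin; have hS0 := posdefmx_possemidef hS.
have [P [hP VP]] := value_qform hW hS0 fin.
exists (riccati_gain B S P); split=> [x0|x0 x u ax cx].
  have [z [[hu tz] cz]] := closed_loop_cost hW hS fin hP VP x0.
  exists z; split=> //; first by rewrite (le_lt_trans cz)// ltey.
  by move=> v y hv ty; apply: (le_trans cz); apply: value_le => //; split.
have Px : P *m x0 = 0.
  apply: possemidef_qform0 => //; apply/eqP; rewrite eq_le hP.2 andbT -VP.
  by have := value_le hW hS0 fin ax; rewrite cx lee_fin.
by rewrite /riccati_gain mulNmx trmx_mul hP.1 -!mulmxA Px !mulmx0 oppr0.
Qed.

End OptimalFeedback.

(** * Finiteness of the cost under controllability *)

Section FiniteCost.
Context {R : realType}.
Local Notation mu := (@lebesgue_measure R).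
Local Notation L2 := loc_square_integrable.

Lemma sqint_truncate (f : R -> R) (T : R) : sqint f ->
  sqint (fun t => if t <= T then f t else 0).
Proof.
move=> [mf if2].
have mt : measurable_fun (`[0, +oo[ : set R) (fun t => if t <= T then f t else 0).
  apply: measurable_fun_if => //.
  - exact: measurable_fun_ler.
  - by apply: measurable_funS mf => // t [].
split=> // T' T'0.
apply: (@le_integrable _ _ _ mu _ _ _ (fun t => (f t ^+ 2)%:E)) => //; last exact: if2.
  apply/measurable_EFinP/measurable_funX.
  by apply: measurable_funS mt => //; exact: subset_itv0y.
by move=> t _; case: ifP => // _; rewrite expr0n /= normr0 lee_fin.
Qed.

Section System.
Variables (m q : nat) (A : 'M[R]_m) (B : 'M[R]_(m, q)) (W : 'M[R]_m) (S : 'M[R]_q).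
Hypotheses (hW : possemidefmx W) (hS : possemidefmx S).
Local Notation adm := (admissible A B).

Definition finite_cost_from x0 := exists x u, adm x0 x u /\ (cost W S x u < +oo)%E.

Lemma finite_cost0 : finite_cost_from 0.
Proof.
exists (fun=> 0), (fun=> 0); split.
  apply: admissibleP => [||t i t0]; [exact: L2_cst..|].
  by rewrite !mulmx0 addr0 mxE Rintegral_itv0_cst// mul0r addr0.
rewrite /cost integral0_eq// => t _.
by rewrite /qform !mulmx0 !mxE addr0.
Qed.

Lemma finite_costD x0 y0 :
  finite_cost_from x0 -> finite_cost_from y0 -> finite_cost_from (x0 + y0).
Proof.
move=> [x [u [ax cx]]] [y [v [ay cy]]].
have [hx hu] := admissible_L2 ax; have [hy hv] := admissible_L2 ay.
exists (fun t => x t + y t), (fun t => u t + v t); split.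
  have := admissible_comb 1 1 ax ay; rewrite !scale1r.
  under [X in admissible _ _ _ X _]eq_fun do rewrite !scale1r.
  by under [X in admissible _ _ _ _ X]eq_fun do rewrite !scale1r.
have := cost_parallelogram hW hS hx hy hu hv => h.
apply: (@le_lt_trans _ _ (2%:E * cost W S x u + 2%:E * cost W S y v)%E).
  by rewrite -h leeDl// cost_ge0.
by rewrite lte_add_pinfty// lte_mul_pinfty// lee_fin.
Qed.

Lemma finite_cost_sum (I : finType) (w : I -> 'cV[R]_m) :
  (forall i, finite_cost_from (w i)) -> finite_cost_from (\sum_i w i).
Proof.
by move=> hw; elim/big_ind: _ => //; [exact: finite_cost0|exact: finite_costD].
Qed.

(** Once the origin is reached, the input is switched off and the state stays
    there. *)
Lemma steered_finite_cost x0 x u T : 0 <= T -> adm x0 x u -> x T = 0 ->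
  finite_cost_from x0.
Proof.
move=> T0 ax xT; have [hx hu] := admissible_L2 ax.
pose cut k (f : R -> 'cV[R]_k) t : 'cV[R]_k := if t <= T then f t else 0.
have L2cut k f : L2 f -> L2 (cut k f).
  move=> hf i; rewrite -[_ /\ _]/(sqint _).
  rewrite (_ : (fun t => _) = fun t => if t <= T then f t i 0 else 0).
    exact/sqint_truncate/hf.
  by apply/funext => t; rewrite /cut; case: ifP => // _; rewrite mxE.
have hx' := L2cut _ _ hx; have hu' := L2cut _ _ hu.
exists (cut _ x), (cut _ u); split.
  apply: admissibleP => // t i t0.
  have agree r : 0 <= r -> r <= T -> \int[mu]_(s in `[0, r])
      ((A *m cut _ x s + B *m cut _ u s) i 0) = x r i 0 - x0 i 0.
    move=> r0 rT; rewrite (admissibleE i ax r0) addrC addKr.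
    apply: eq_Rintegral => s /set_mem /=; rewrite in_itv/= => /andP[_ sr].
    by rewrite /cut (le_trans sr rT).
  rewrite [in LHS]/cut; case: leP => tT; first by rewrite agree// addrC subrK.
  have iv := sqint_integrable (L2_velocity A B hx' hu' i) t0.
  have := Rintegral_itvB iv; move=> /(_ T); rewrite !bnd_simp => /(_ T0 (ltW tT)).
  rewrite (agree T T0 (lexx T)) xT => h; rewrite -[X in _ + X](subrK (0 - x0 i 0)).
  rewrite !mxE in h *; rewrite h (@eq_Rintegral _ (measurableTypeR R) R mu _ (cst 0)).
    by rewrite Rintegral_cst// mul0r add0r sub0r subrr.
  move=> s /set_mem /=; rewrite in_itv/= => /andP[Ts _].
  by rewrite /cut leNgt Ts /= !mulmx0 addr0 mxE.
(* The truncated input need not vanish at time T itself, so the cost is split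
   after T. *)
have T1 : 0 <= T + 1 by rewrite addr_ge0.
rewrite (cost_shift hW hS T1 hx' hu') lte_add_pinfty ?ltry//.
rewrite /cost integral0_eq// => t; rewrite /= in_itv/= andbT => t0.
have tT : (t + (T + 1) <= T) = false by apply/negbTE; rewrite -ltNge; lra.
by rewrite /cut tT /qform !mulmx0 !mxE addr0.
Qed.

End System.
End FiniteCost.

(** * Kronecker structure and the asynchronous projection *)

Section Kronecker.
Context {R : realType}.

(** The Kronecker product of the i-th canonical column vector with the identity
    matrix, given by its entries because that product has 1 * k columns. *)
Definition block_inj N k (i : 'I_N) : 'M[R]_(N * k, k) :=
  \matrix_(r, l) (((mxtens_unindex r).1 == i) && ((mxtens_unindex r).2 == l))%:R.

Lemma tens1mx_block_inj N a b (M : 'M[R]_(a, b)) (i : 'I_N) :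
  ((1%:M : 'M[R]_N) *t M) *m block_inj b i = block_inj a i *m M.
Proof.
apply/matrixP => r l; rewrite !mxE.
rewrite (bigD1 (mxtens_index (i, l)))//= big1 => [|s sil]; last first.
  rewrite !mxE; have [e1|_] := eqVneq (mxtens_unindex s).1 i; last by rewrite mulr0.
  have [e2|_] := eqVneq (mxtens_unindex s).2 l; last by rewrite andbF mulr0.
  by case/eqP: sil; rewrite -e1 -e2 -[LHS]mxtens_unindexK; case: (mxtens_unindex s).
rewrite !mxE mxtens_indexK/= !eqxx mulr1 addr0.
rewrite (bigD1 (mxtens_unindex r).2)//= big1 => [|s sr]; last first.
  by rewrite !mxE [_ == s]eq_sym (negbTE sr) andbF mul0r.
by rewrite !mxE eqxx andbT addr0.
Qed.

Lemma sum_block_inj N k (x : 'cV[R]_(N * k)) :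
  x = \sum_i block_inj k i *m \col_l x (mxtens_index (i, l)) 0.
Proof.
apply/colP => r; rewrite summxE (bigD1 (mxtens_unindex r).1)//= big1 => [|i ir]; last first.
  by rewrite mxE big1// => l _; rewrite !mxE eq_sym (negbTE ir) mul0r.
rewrite addr0 mxE (bigD1 (mxtens_unindex r).2)//= big1 => [|l lr]; last first.
  by rewrite !mxE [_ == l]eq_sym (negbTE lr) andbF mul0r.
rewrite !mxE !eqxx mul1r addr0; congr (x _ _).
by rewrite -[LHS]mxtens_unindexK.
Qed.

Lemma mulmx_eq0_col a b (M : 'M[R]_(a, b)) : (forall w : 'cV_b, M *m w = 0) -> M = 0.
Proof.
move=> M0; apply/matrixP => i j; have /colP/(_ i) := M0 (delta_mx j 0).
by rewrite -colE !mxE.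
Qed.

Lemma trmx_mul_eq0 k (y : 'cV[R]_k) : y^T *m y = 0 -> y = 0.
Proof.
move=> /matrixP/(_ 0 0); rewrite !mxE => yy; apply/colP => i; rewrite mxE.
have sq j : y^T 0 j * y j 0 = y j 0 ^+ 2 by rewrite mxE.
rewrite (eq_bigr _ (fun j _ => sq j)) in yy.
apply/eqP; rewrite -sqrf_eq0; apply/eqP.
by move/psumr_eq0P: yy; apply=> // j _; exact: sqr_ge0.
Qed.

(** If x is synchronised then y = PA x is orthogonal to x, being asynchronous, and
    to x - y, so it is orthogonal to itself. *)
Lemma async_proj_ones N n (PA : 'M[R]_(N * n)) :
  is_orth_proj (@async_subspace R N n) PA -> PA *m ones_kron R N n = 0.
Proof.
move=> hPA; apply: mulmx_eq0_col => w; rewrite -mulmxA.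
set x := _ *m w; have [aP oP] := hPA x.
have xP : x^T *m (PA *m x) = 0 by apply: aP; exists w.
have := oP _ aP; rewrite mulmxBr.
have -> : (PA *m x)^T *m x = 0 by rewrite -[LHS]trmxK trmx_mul trmxK xP trmx0.
move=> /eqP; rewrite sub0r oppr_eq0 => /eqP yy.
exact: trmx_mul_eq0.
Qed.

Lemma possemidefmx_congr m (Q P : 'M[R]_m) : posdefmx Q -> possemidefmx (P^T *m Q *m P).
Proof.
move=> /posdefmx_possemidef[sQ pQ]; split=> [|x]; last by rewrite -qform_mul.
by rewrite !trmx_mul trmxK sQ mulmxA.
Qed.

End Kronecker.

Theorem theorem2 (R : realType) (N n p : nat) (hN : (2 <= N)%N)
    (A : 'M[R]_n) (B : 'M[R]_(n, p)) (hAB : controllable A B)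
    (Q : 'M[R]_(N * n)) (S : 'M[R]_(N * p))
    (hQ : posdefmx Q) (hS : posdefmx S)
    (PA : 'M[R]_(N * n)) (hPA : is_orth_proj (@async_subspace R N n) PA) :
  exists K : 'M[R]_(N * p, N * n),
    optimal_feedback ((1%:M : 'M[R]_N) *t A) ((1%:M : 'M[R]_N) *t B)
      (PA^T *m Q *m PA) S K /\
    diffusive K.
Proof.
have hW := possemidefmx_congr PA hQ; have hS0 := posdefmx_possemidef hS.
set A' := _ *t A; set B' := _ *t B; set W := _ *m PA in hW *.
(* Superposition reduces to initial states in which one agent is active, and
   each agent is steered to the origin in its own time. *)
have fin x0 : finite_cost_from A' B' W S x0.
  rewrite (sum_block_inj x0); apply: finite_cost_sum => // i.
  set w := \col_l _; have [T [u [x [T0 hu tx xT]]]] := hAB w 0.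
  have ax : admissible A B w x u by [].
  apply: (@steered_finite_cost _ _ _ A' B' W S hW hS0 _ _ _ T (ltW T0)
    (admissible_intertwine (tens1mx_block_inj A i) (tens1mx_block_inj B i) ax)).
  by rewrite xT mulmx0.
have [K [optK K0]] := exists_optimal_feedback hW hS fin.
exists K; split=> //; apply: mulmx_eq0_col => w; rewrite -mulmxA.
(* A synchronised state is the image under E of a state w of a single copy of the
   system, and so is its free motion. *)
pose A1 := (1%:M : 'M[R]_1) *t A; pose E := ones_kron R N n.
have AE : A' *m E = E *m A1 by rewrite /A' /E /A1 /ones_kron !tensmx_mul mul1mx !mulmx1 mul1mx.
have [z [_ az]] := admissible_closed_loop A1 (0 : 'M[R]_(1 * n, N * p)) 0 w.
have B0 : B' *m (0 : 'M[R]_(N * p)) = E *m (0 : 'M[R]_(1 * n, N * p)) by rewrite !mulmx0.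
apply: (K0 _ _ _ (admissible_intertwine AE B0 az)).
rewrite /cost integral0_eq// => t _.
rewrite /qform /W -!mulmxA [PA *m (E *m _)]mulmxA (async_proj_ones hPA).
by rewrite !mul0mx !mulmx0 !mxE addr0.
Qed.
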